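(* Let $G$ be a $C$-orderable group. If $G$ admits only finitely many $C$-orderings, then $G$ admits a unique (hence normal) rational series $$\{id\}=G_0\lhd G_1\lhd\ldots\lhd G_{n-1}\lhd G_n=G,$$ and in this series no quotient $G_{i+2}/G_i$ ($0\le i\le n-2$) is Abelian. Conversely, if $G$ is a group admitting a normal rational series $$\{id\}=G_0\lhd G_1\lhd\ldots\lhd G_{n-1}\lhd G_n=G$$ such that no quotient $G_{i+2}/G_i$ ($0\le i\le n-2$) is Abelian, then the number of $C$-orderings on $G$ equals $2^n$.
   Context: A left-ordering on a group $G$ is a left-invariant total order $\preceq$ on $G$. An element $g$ is positive if $g\succ id$. A left-ordering $\preceq$ is Conradian (a $C$-ordering) if for all positive $f,g\in G$ there is $n\in\mathbb{N}=\{1,2,\ldots\}$ with $fg^n\succ g$. A group is $C$-orderable if it admits at least one $C$-ordering. A series of subgroups $\{id\}=G_0\lhd G_1\lhd\ldots\lhd G_n=G$ is rational if it is subnormal (each $G_i$ is normal in $G_{i+1}$) and each quotient $G_{i+1}/G_i$ is torsion-free Abelian of rank 1 (i.e. isomorphic to a nontrivial subgroup of $(\mathbb{Q},+)$). The series is normal if each $G_i$ is normal in $G$. *)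

(* Defs.v *)
From HB Require Import structures.
From mathcomp Require Import all_boot ssralg ssrint.
From mathcomp Require Import boolp classical_sets functions cardinality.

Set Implicit Arguments.
Unset Strict Implicit.
Unset Printing Implicit Defensive.

Local Open Scope classical_set_scope.
Local Open Scope quotient_scope.
Local Open Scope group_scope.

Section Orderings.
Variable G : groupType.
Implicit Type r : rel G.

(* [r x y] reads x <= y; the associated strict order is [slt r]. *)
Definition slt r : rel G := fun x y => r x y && (x != y).

Definition positive r (g : G) : bool := slt r 1 g.

Definition left_ordering r : Prop :=
  [/\ reflexive r, antisymmetric r, transitive r, total r
    & forall f g h : G, r g h -> r (f * g) (f * h)].

Definition C_ordering r : Prop :=
  left_ordering r /\
  forall f g : G, positive r f -> positive r g ->
    exists2 n : nat, (0 < n)%N & slt r g (f * g ^+ n).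

Definition C_orderings : set (rel G) := [set r | C_ordering r].

Definition C_orderable : Prop := exists r, C_ordering r.

End Orderings.

Arguments C_orderings G : clear implicits.

Section Subgroups.
Variable G : groupType.

(* Subgroups are the predicates of type [groupClosed G]. *)
Lemma groupClosed_ext (H K : groupClosed G) : H =i K -> H = K.
Proof.
move=> eHK; have {}eHK : (H : {pred G}) = (K : {pred G}).
  by apply/funext => x; have := eHK x; rewrite !unfold_in.
case: H K eHK => [H [[hv] [h1] [hm]]] [K [[kv] [k1] [km]]] /= eHK.
by subst K; rewrite (Prop_irrelevance hv kv) (Prop_irrelevance h1 k1)
  (Prop_irrelevance hm km).
Qed.

Definition trivg_pred : {pred G} := pred1 1.

Lemma trivg_group_closed : group_closed trivg_pred.
Proof.
split; first exact: eqxx.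
by move=> x y; rewrite !inE => /eqP-> /eqP->; rewrite mulgV.
Qed.

HB.instance Definition _ := isMulClosed.Build G trivg_pred
  (group_closedM trivg_group_closed).
HB.instance Definition _ := isMul1Closed.Build G trivg_pred
  trivg_group_closed.1.
HB.instance Definition _ := isInvClosed.Build G trivg_pred
  (group_closedV trivg_group_closed).

Definition trivg : groupClosed G := trivg_pred.

Definition normal_in (N H : groupClosed G) : Prop :=
  {subset N <= H} /\ {in H & N, forall x y, y ^ x \in N}.

Definition normaliser (N : groupClosed G) : {pred G} :=
  fun x => `[< forall y, (y ^ x \in N) = (y \in N) >].

Lemma normaliserP (N : groupClosed G) x :
  reflect (forall y, (y ^ x \in N) = (y \in N)) (x \in normaliser N).
Proof. exact: asboolP. Qed.

Lemma normaliser_group_closed (N : groupClosed G) :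
  group_closed (normaliser N).
Proof.
split; first by apply/normaliserP => y; rewrite conjg1.
move=> x y /normaliserP nx /normaliserP ny; apply/normaliserP => z.
by rewrite conjgM -(ny (_ ^ y^-1)) -conjgM mulVg conjg1.
Qed.

Lemma normal_in_normaliser (N H : groupClosed G) :
  normal_in N H -> {subset H <= normaliser N}.
Proof.
move=> [_ nNH] x Hx; apply/normaliserP => y; apply/idP/idP => [Ny|]; last first.
  exact: nNH.
by rewrite -[y]conjg1 -(mulgV x) conjgM nNH // gpredVr.
Qed.

End Subgroups.

(* The quotient [coset_of N] of the normaliser of N by N makes sense for every
   subgroup N; [quotient N H] is the image in it of the part of H that
   normalises N, so it is H/N as soon as N is normal in H. *)
Section Quotient.
Variables (G : groupType) (N : groupClosed G).

Record normaliser_of := NormaliserOf {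
  normaliser_val : G;
  _ : normaliser_val \in normaliser N
}.

HB.instance Definition _ := [isSub for normaliser_val].
HB.instance Definition _ := [Choice of normaliser_of by <:].
HB.instance Definition _ :=
  SubChoice_isSubGroup.Build G _ normaliser_of (normaliser_group_closed N).

Definition coset_eq : rel normaliser_of := fun x y => val x^-1 * val y \in N.

Lemma coset_eq_equiv : equiv_class_of coset_eq.
Proof.
split=> [x|x y|y x z]; rewrite /coset_eq.
- by rewrite mulVg gpred1.
- by rewrite -gpredV invgM invgK.
- by move=> xy yz; rewrite -[val z](mulVKg (val y)) mulgA gpredM.
Qed.

Canonical coset_eq_equivRel := EquivRelPack coset_eq_equiv.
Canonical coset_eq_encModRel := defaultEncModRel coset_eq.

Definition coset_of := {eq_quot coset_eq}.

HB.instance Definition _ := EqQuotient.on coset_of.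
HB.instance Definition _ := Choice.on coset_of.

Definition coset_one : coset_of := \pi 1.
Definition coset_inv (a : coset_of) : coset_of := \pi_coset_of (repr a)^-1.
Definition coset_mul (a b : coset_of) : coset_of :=
  \pi_coset_of (repr a * repr b).

Lemma coset_piE (x y : normaliser_of) :
  (\pi_coset_of x == \pi_coset_of y) = ((val x)^-1 * val y \in N).
Proof. exact: pi_eq_quot. Qed.

Lemma coset_repr (x : normaliser_of) :
  (val (repr (\pi_coset_of x)))^-1 * val x \in N.
Proof. by rewrite -coset_piE reprK. Qed.

Lemma coset_piM (x y : normaliser_of) :
  coset_mul (\pi_coset_of x) (\pi_coset_of y) = \pi_coset_of (x * y).
Proof.
apply/eqP; rewrite coset_piE !valM.
set a := val (repr _); set b := val (repr _).
have -> : (a * b)^-1 * (val x * val y) =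
  (b^-1 * val y) * (a^-1 * val x) ^ val y.
  by rewrite /conjg invgM !mulgA mulgK.
rewrite gpredM ?coset_repr //.
by have /normaliserP -> := valP y; apply: coset_repr.
Qed.

Lemma coset_piV (x : normaliser_of) :
  coset_inv (\pi_coset_of x) = \pi_coset_of x^-1.
Proof.
apply: (@eqP _ _ _); rewrite coset_piE.
have valV (y : normaliser_of) : val y^-1 = (val y)^-1.
  by apply: (mulgI (val y)); rewrite -valM !mulgV val1.
rewrite !valV invgK.
set a := val (repr _).
have -> : a * (val x)^-1 = ((a^-1 * val x) ^ (val x)^-1)^-1.
  by rewrite /conjg !invgM !invgK !mulgA mulgV mul1g.
rewrite gpredV -valV; have /normaliserP -> := valP x^-1.
exact: coset_repr.
Qed.

Lemma coset_surj (a : coset_of) : exists x, a = \pi_coset_of x.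
Proof. by exists (repr a); rewrite reprK. Qed.

Lemma coset_mulA : associative coset_mul.
Proof.
move=> a b c; have [x ->] := coset_surj a; have [y ->] := coset_surj b.
by have [z ->] := coset_surj c; rewrite !coset_piM mulgA.
Qed.

Lemma coset_mul1 : left_id coset_one coset_mul.
Proof. by move=> a; have [x ->] := coset_surj a; rewrite coset_piM mul1g. Qed.

Lemma coset_mulr1 : right_id coset_one coset_mul.
Proof. by move=> a; have [x ->] := coset_surj a; rewrite coset_piM mulg1. Qed.

Lemma coset_mulV : left_inverse coset_one coset_inv coset_mul.
Proof. by move=> a; have [x ->] := coset_surj a; rewrite coset_piV coset_piM mulVg. Qed.

Lemma coset_mulrV : right_inverse coset_one coset_inv coset_mul.
Proof. by move=> a; have [x ->] := coset_surj a; rewrite coset_piV coset_piM mulgV. Qed.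

HB.instance Definition _ := isGroup.Build coset_of
  coset_mulA coset_mul1 coset_mulr1 coset_mulV coset_mulrV.

(* The value 1 outside the normaliser is junk. *)
Definition coset (x : G) : coset_of := \pi_coset_of (insubd 1%g x).

Definition quotient (H : groupClosed G) : set coset_of :=
  [set coset x | x in [set x | x \in H /\ x \in normaliser N]].

Lemma cosetM : {in normaliser N &, {morph coset : x y / x * y}}.
Proof.
move=> x y nx ny; have nxy : x * y \in normaliser N.
  exact: (group_closedM (normaliser_group_closed N)).
rewrite /coset [RHS]coset_piM; congr (\pi_coset_of _); apply: val_inj.
by rewrite valM !insubdK.
Qed.

Lemma coset_eqP : {in normaliser N &, forall x y,
  coset x = coset y <-> x^-1 * y \in N}.
Proof.
move=> x y nx ny; have := coset_piE (insubd 1 x) (insubd 1 y).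
by rewrite !insubdK // => <-; rewrite /coset; split=> [->|/eqP].
Qed.

End Quotient.

Arguments coset {G} N x.
Arguments quotient {G} N H.

Section AbelianSets.
Variable T : groupType.
Implicit Type A : set T.

Definition expgz (x : T) (k : int) : T :=
  match k with Posz n => x ^+ n | Negz n => x ^- n.+1 end.

Definition abelian_set A : Prop := forall x y, A x -> A y -> commute x y.

Definition torsion_free A : Prop :=
  forall x (n : nat), A x -> (0 < n)%N -> x ^+ n = 1 -> x = 1.

Definition independent (r : nat) (e : 'I_r -> T) : Prop :=
  forall k : 'I_r -> int,
    \prod_(i < r) expgz (e i) (k i) = 1 -> forall i, k i = 0%R.

(* Rank of an Abelian group: maximal size of a Z-independent family. *)
Definition has_rank A (r : nat) : Prop :=
  (exists2 e : 'I_r -> T, forall i, A (e i) & independent e) /\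
  forall e : 'I_r.+1 -> T, (forall i, A (e i)) -> ~ independent e.

Definition torsion_free_abelian_rank1 A : Prop :=
  [/\ abelian_set A, torsion_free A & has_rank A 1].

End AbelianSets.

(* A series G_0, ..., G_n is a sequence of n.+1 subgroups; the default value of
   [nth] is never used. *)
Section Series.
Variable G : groupType.
Implicit Type s : seq (groupClosed G).

Definition term s (i : nat) : groupClosed G := nth (trivg G) s i.

Definition subnormal_series s : Prop :=
  [/\ (0 < size s)%N, term s 0 =i pred1 1, term s (size s).-1 =i predT
    & forall i, (i.+1 < size s)%N -> normal_in (term s i) (term s i.+1)].

Definition rational_series s : Prop :=
  subnormal_series s /\
  forall i, (i.+1 < size s)%N ->
    torsion_free_abelian_rank1 (quotient (term s i) (term s i.+1)).

Definition normal_series s : Prop :=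
  forall i, (i < size s)%N ->
    forall x y : G, y \in term s i -> y ^ x \in term s i.

Definition no_abelian_double_step s : Prop :=
  forall i, (i.+2 < size s)%N ->
    ~ abelian_set (quotient (term s i) (term s i.+2)).

End Series.

(* Main.v *)
From HB Require Import structures.
Require Import Defs.
From mathcomp Require Import all_boot.
From mathcomp Require Import boolp classical_sets functions cardinality.
From mathcomp Require Import ssralg ssrnum ssrint zify.

Set Implicit Arguments.
Unset Strict Implicit.
Unset Printing Implicit Defensive.

(** A Conradian order is handled through its set of positive elements, and more
    generally through cones that order the cosets of a subgroup K in a subgroup
    H ([relcone]). Lexicographic composition ([relcone_lex]) glues a cone of
    H / K to one of K, and a convex subgroup splits a cone the other way
    ([convex_top], [relcone_restrict]).

    The Conrad property, which may be taken with exponent 2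
    ([relcone_conrad2]), implies that the elements lying between two powers of
    a positive b form a convex subgroup D ([dominated_group]). If C is the
    largest convex subgroup missing b, the order on D / C is archimedean, so C
    is normal in D and D / C is Abelian by Hoelder's theorem ([jump_abelian]).

    The source of infinitely many orders is [two_generators_infinite]: in a
    torsion-free Abelian quotient with two independent elements x and y, Zorn's
    lemma yields for every k an order in which y lies between x^k and x^(k+1).

    Let G have finitely many Conradian orders. Reversing an order on a convex
    subgroup yields a new order, so there are finitely many subgroups D as
    above, and the largest one is G; the corresponding C is the top proper term
    of a rational series, since an independent pair in G / C would give
    infinitely many orders ([finite_top_step]). Every order on C extends to G
    in at least two ways, so C has fewer orders and induction gives the whole
    series ([chain_exists]). Two different top terms K and K' would give an
    independent pair modulo their intersection ([step_unique]), which proves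
    uniqueness from the top down; normality follows by applying uniqueness to
    conjugates, and an Abelian double quotient would again contain an
    independent pair.

    Conversely, the first term of a normal rational series is convex for every
    order. Let L < K < H be successive terms
    with H / L not Abelian, and suppose that L is convex in K. Then K is convex
    in H for every order on H ([double_step_convex]): choose b > 1 in K and x in
    H whose commutator is not in L. Any convex subgroup that meets K outside L
    contains K, because K / L has rank one. If b dominated an element outside
    K, it would dominate x, as H / K has rank one; then the commutator of b and
    x would lie in the largest convex subgroup missing b, which would contain K
    and thus b. So an order on H consists of an order on K and an order on
    H / K, of which there are two ([step_cone_eq]); the number of orders doubles
    at each of the n steps. *)

Local Open Scope card_scope.
Local Open Scope classical_set_scope.
Local Open Scope group_scope.

(** * Subgroups and group words *)

Lemma subgroup_exists (G : groupType) (A : set G) :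
  A 1 -> (forall x y, A x -> A y -> A (x * y)) -> (forall x, A x -> A x^-1) ->
  exists K : groupClosed G, forall x, (x \in K) <-> A x.
Proof.
move=> A1 AM AV; pose p : {pred G} := fun x => `[< A x >].
have pE x : (x \in p) <-> A x by split=> /asboolP.
have m1 : 1 \in p by apply/pE.
have mM : mulg_closed p by move=> x y /pE Ax /pE Ay; apply/pE; apply: AM.
have mV : invg_closed p by move=> x /pE Ax; apply/pE; apply: AV.
pose K : groupClosed G := HB.pack p (isMulClosed.Build G p mM)
  (isMul1Closed.Build G p m1) (isInvClosed.Build G p mV).
by exists K.
Qed.

(** A terminating rewrite system for the word problem, with products associated
    to the left. *)
Definition groupE (G : groupType) :=
  (@invgM G, @invgK G, @invg1 G, @mulgA G, @mulg1 G, @mul1g G, @mulgK G,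
   @mulgVK G, @mulgV G, @mulVg G).

Definition abelian_mod (G : groupType) (N H : groupClosed G) : Prop :=
  {in H &, forall x y, [~ x, y] \in N}.

Definition torsion_free_mod (G : groupType) (N H : groupClosed G) : Prop :=
  forall x n, x \in H -> (0 < n)%N -> x ^+ n \in N -> x \in N.

(** * Conradian orders on coset spaces *)

(** The positive cone of a left-invariant Conradian order on the cosets of K in
    H, with x < y read as T (x^-1 * y); for trivial K it is a Conradian order
    of H. Orders relative to K let convex subgroups and Abelian quotients be
    treated alike, and K is not assumed normal because a convex subgroup need
    not be. *)
Record relcone (G : groupType) (H K : groupClosed G) (T : set G) : Prop :=
    RelCone {
  relcone_sub : {subset K <= H};
  relcone_dom : forall x, T x -> x \in H;
  relcone_base : forall x, T x -> x \notin K;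
  relcone_tri : forall x, x \in H -> [\/ T x, x \in K | T x^-1];
  relconeM : forall x y, T x -> T y -> T (x * y);
  relcone_mull : forall k x, k \in K -> T x -> T (k * x);
  relcone_mulr : forall x k, T x -> k \in K -> T (x * k);
  relcone_conrad : forall f g, T g -> T f \/ f \in K ->
    exists n : nat, T (g^-1 * f * g ^+ n) }.

(** The elements >= 1 of the order on cosets. *)
Definition wcone (G : groupType) (K : groupClosed G) (T : set G) (x : G) :=
  T x \/ x \in K.


Section RelCone.
Variables (G : groupType) (H K : groupClosed G) (T : set G).
Hypothesis cT : relcone H K T.

Lemma wcone1 : wcone K T 1. Proof. by right; apply: gpred1. Qed.

Lemma wcone_dom x : wcone K T x -> x \in H.
Proof. by case=> [/(relcone_dom cT)|/(relcone_sub cT)]. Qed.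

Lemma wconeMl x y : wcone K T x -> T y -> T (x * y).
Proof. by case=> [|xK] Ty; [apply: (relconeM cT)|apply: (relcone_mull cT)]. Qed.

Lemma wconeMr x y : T x -> wcone K T y -> T (x * y).
Proof.
by move=> Tx [|yK]; [apply: (relconeM cT)|apply: (relcone_mulr cT)].
Qed.

Lemma wconeM x y : wcone K T x -> wcone K T y -> wcone K T (x * y).
Proof.
case=> [Tx Wy|xK [Ty|yK]]; [left; exact: wconeMr| |by right; apply: gpredM].
by left; apply: wconeMl => //; right.
Qed.

Lemma wconeX x n : wcone K T x -> wcone K T (x ^+ n).
Proof.
move=> Wx; elim: n => [|n IHn]; first exact: wcone1.
by rewrite expgS; apply: wconeM.
Qed.

Lemma relconeX x n : T x -> T (x ^+ n.+1).
Proof.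
by move=> Tx; rewrite expgS; apply: wconeMr => //; apply: wconeX; left.
Qed.

Lemma relcone1 : ~ T 1.
Proof. by move/(relcone_base cT); rewrite gpred1. Qed.

Lemma relcone_asym x : T x -> ~ wcone K T x^-1.
Proof. by move=> Tx /(wconeMr Tx); rewrite mulgV; apply: relcone1. Qed.

Lemma wcone_total x : x \in H -> ~ T x -> wcone K T x^-1.
Proof.
by move=> /(relcone_tri cT)[//|xK _|Tx _]; [right; rewrite gpredV|left].
Qed.

(** The Conrad property always holds with exponent 2. Otherwise h := f * g
    satisfies h * g <= g, hence h ^ n <= g for every n; but the Conrad property
    for f and h gives h < f * h ^ n, that is g < h ^ n, for some n. *)
Lemma relcone_conrad2 f g : T g -> wcone K T f -> T (g^-1 * f * g * g).
Proof.
move=> Tg Wf; apply: contrapT => nT.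
have gH := relcone_dom cT Tg.
have fH := wcone_dom Wf.
have hH : g^-1 * f * g * g \in H by rewrite !gpredM ?gpredV.
have := wcone_total hH nT; rewrite !groupE => Wh.
have Tfg := wconeMl Wf Tg.
have [n] := relcone_conrad cT Tfg Wf.
have -> : (f * g)^-1 * f * (f * g) ^+ n = g^-1 * (f * g) ^+ n by rewrite !groupE.
suff Wn : wcone K T ((f * g) ^- n * g).
  by move=> /relcone_asym; apply; rewrite !groupE.
elim: n => [|n IHn]; first by left; rewrite expg0 invg1 mul1g.
rewrite expgS.
have -> : (f * g * (f * g) ^+ n)^-1 * g
  = ((f * g) ^- n * g) * (g^-1 * g^-1 * f^-1 * g) by rewrite !groupE.
exact: wconeM.
Qed.

(** The exponent 2 property for the reverse order. *)
Lemma relcone_conradV f g : T g -> wcone K T f -> T (g * g * f * g^-1).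
Proof.
move=> Tg Wf; apply: contrapT => nT.
have gH := relcone_dom cT Tg.
have fH := wcone_dom Wf.
have hH : g * g * f * g^-1 \in H by rewrite !gpredM ?gpredV.
have := relcone_conrad2 Tg (wcone_total hH nT); rewrite !groupE => TfV.
by apply: (relcone_asym TfV); rewrite invgK.
Qed.

(** Conjugation by g ^ m costs at most a further factor g ^ m. *)
Lemma relcone_conradX f g m : T g -> wcone K T f ->
  wcone K T (g ^- m * f * g ^+ m * g ^+ m).
Proof.
move=> Tg Wf; elim: m => [|m IHm]; first by rewrite expg0 !groupE.
have -> : g ^- m.+1 * f * g ^+ m.+1 * g ^+ m.+1
  = g^-1 * (g ^- m * f * g ^+ m * g ^+ m) * g * g.
  have gm : g ^+ m * g = g * g ^+ m by rewrite -expgS expgSr.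
  by rewrite expgSr !groupE -(mulgA _ g (g ^+ m)) -gm !groupE.
by left; apply: relcone_conrad2.
Qed.

Lemma relcone_conradVX f g m : T g -> wcone K T f ->
  wcone K T (g ^+ m * g ^+ m * f * g ^- m).
Proof.
move=> Tg Wf; elim: m => [|m IHm]; first by rewrite expg0 !groupE.
have -> : g ^+ m.+1 * g ^+ m.+1 * f * g ^- m.+1
  = g * g * (g ^+ m * g ^+ m * f * g ^- m) * g^-1.
  have gm : g ^+ m * g = g * g ^+ m by rewrite -expgS expgSr.
  by rewrite expgS !groupE -(mulgA _ (g ^+ m) g) gm !groupE.
by left; apply: relcone_conradV.
Qed.

Lemma relcone_torsion : torsion_free_mod K H.
Proof.
move=> x [//|n] xH _ xnK; case: (relcone_tri cT xH) => // [|] Tx.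
  by have := relcone_base cT (relconeX n Tx); rewrite xnK.
by have := relcone_base cT (relconeX n Tx); rewrite expVgn gpredV xnK.
Qed.

Lemma relcone_opp : relcone H K [set x | T x^-1].
Proof.
split=> /=.
- exact: (relcone_sub cT).
- by move=> x /(relcone_dom cT); rewrite gpredV.
- by move=> x /(relcone_base cT); rewrite gpredV.
- move=> x xH; rewrite invgK.
  by case: (relcone_tri cT xH) => ?; [constructor 3|constructor 2|constructor 1].
- by move=> x y Tx Ty; rewrite invgM; apply: (relconeM cT).
- by move=> k x kK Tx; rewrite invgM; apply: (relcone_mulr cT); rewrite ?gpredV.
- by move=> k x Tx kK; rewrite invgM; apply: (relcone_mull cT); rewrite ?gpredV.
- move=> f g Tg Wf; exists 2; rewrite expg2 !invgM !invgK.
  have /(relcone_conradV Tg) : wcone K T f^-1.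
    by case: Wf; [left|right; rewrite gpredV].
  by rewrite !groupE.
Qed.

End RelCone.

Section Lex.
Variables (G : groupType) (H K L : groupClosed G) (T Q : set G).
Hypotheses (cT : relcone H K T) (cQ : relcone K L Q).

(** The lexicographic order: first compare modulo K, then inside K. *)
Lemma relcone_lex : relcone H L (Q `|` T).
Proof.
have sub x : (Q `|` T) x \/ x \in L -> wcone K T x.
  case=> [[/(relcone_dom cQ)|]|/(relcone_sub cQ)]; [by right|by left|by right].
split.
- by move=> x /(relcone_sub cQ)/(relcone_sub cT).
- by move=> x [/(relcone_dom cQ)/(relcone_sub cT)|/(relcone_dom cT)].
- move=> x [/(relcone_base cQ)//|/(relcone_base cT)].
  by apply/contra/(relcone_sub cQ).
- move=> x /(relcone_tri cT)[Tx|xK|Tx].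
  + by constructor 1; right.
  + case: (relcone_tri cQ xK) => ?; [|by constructor 2|].
      by constructor 1; left.
    by constructor 3; left.
  + by constructor 3; right.
- move=> x y [Qx|Tx] [Qy|Ty]; [by left; apply: (relconeM cQ)| | |]; right.
  + by apply: (wconeMl cT) => //; right; apply: (relcone_dom cQ).
  + by apply: (wconeMr cT) => //; right; apply: (relcone_dom cQ).
  + exact: (relconeM cT).
- move=> k x kL [Qx|Tx]; [by left; apply: (relcone_mull cQ)|right].
  by apply: (relcone_mull cT) => //; apply: (relcone_sub cQ).
- move=> x k [Qx|Tx] kL; [by left; apply: (relcone_mulr cQ)|right].
  by apply: (relcone_mulr cT) => //; apply: (relcone_sub cQ).
- move=> f g [Qg|Tg] Wf; last first.
    exists 2; right; rewrite expg2 !mulgA; apply: (relcone_conrad2 cT) => //.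
    exact: sub.
  have gK := relcone_dom cQ Qg.
  have [Tf|nTf] := pselect (T f).
    exists 0; right; rewrite expg0 mulg1.
    by apply: (wconeMl cT) => //; right; rewrite gpredV.
  have [||n Qn] := @relcone_conrad _ _ _ _ cQ f g => //; last by exists n; left.
  by case: Wf => [[]|]; [left| |right].
Qed.

End Lex.

(** * Convex subgroups *)

Section Convex.
Variables (G : groupType) (H L : groupClosed G) (T : set G).
Hypothesis cT : relcone H L T.

Definition convex (K : groupClosed G) : Prop :=
  [/\ {subset L <= K}, {subset K <= H} & forall x y,
    wcone L T x -> wcone L T y -> x * y \in K -> x \in K].

(** h ^- n < x < h ^+ n for some n. *)
Definition dominated (h x : G) : Prop :=
  exists n : nat, T (h ^+ n * x) /\ T (x^-1 * h ^+ n).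

Lemma convex_r K x y : convex K ->
  wcone L T x -> wcone L T y -> x * y \in K -> y \in K.
Proof.
move=> [_ _ cK] Wx Wy xyK.
by rewrite -(mulKg x y) gpredM // gpredV (cK _ _ Wx Wy xyK).
Qed.

(** A positive element outside a convex subgroup exceeds every element of it;
    this makes the order outside K an order on cosets of K. *)
Lemma convex_mull K k h : convex K -> k \in K -> T h -> h \notin K -> T (k * h).
Proof.
move=> cK kK Th hK; have [_ sKH cvx] := cK; apply: contrapT => nT.
have khH : k * h \in H by apply: gpredM; [exact: sKH|exact: (relcone_dom cT)].
case/negP: hK; apply: (cvx _ (k * h)^-1); first by left.
  exact: (wcone_total cT khH nT).
by rewrite !groupE gpredV.
Qed.

Lemma convex_mulr K k h : convex K -> k \in K -> T h -> h \notin K -> T (h * k).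
Proof.
move=> cK kK Th hK; have [_ sKH cvx] := cK; apply: contrapT => nT.
have hkH : h * k \in H by apply: gpredM; [exact: (relcone_dom cT)|exact: sKH].
case/negP: hK; apply: (convex_r cK (wcone_total cT hkH nT)); first by left.
by rewrite !groupE gpredV.
Qed.

Lemma convex_top K : convex K -> relcone H K [set x | T x /\ x \notin K].
Proof.
move=> cK; have [sLK sKH cvx] := cK; split=> //=.
- by move=> x [/(relcone_dom cT)].
- by move=> x [].
- move=> x xH; have [xK|xK] := boolP (x \in K); first by constructor 2.
  case: (relcone_tri cT xH) => [Tx|/sLK|Tx]; first by constructor 1.
    by rewrite (negPf xK).
  by constructor 3; rewrite gpredV.
- move=> x y [Tx xK] [Ty yK]; split; first exact: (relconeM cT).
  by apply: contra xK; apply: cvx; left.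
- move=> k x kK [Tx xK]; split; first exact: (convex_mull cK).
  by rewrite gpredMl.
- move=> x k [Tx xK] kK; split; first exact: (convex_mulr cK).
  by rewrite gpredMr.
- move=> f g [Tg gK] Wf.
  (* [relcone_conrad2] accounts for two of the factors; one more makes f * g
     positive when f in K is negative, and the last keeps the product out of
     K. *)
  exists 4.
  have [Tfg fgK] : T (f * g) /\ f * g \notin K.
    case: Wf => [[Tf fK]|fK].
      split; first exact: (relconeM cT).
      by apply: contra fK; apply: cvx; left.
    by split; [apply: (convex_mull cK)|rewrite gpredMl].
  have T2 : T (g^-1 * (f * g) * g * g) by apply: (relcone_conrad2 cT) => //; left.
  have -> : g^-1 * f * g ^+ 4 = g^-1 * (f * g) * g * g * g.
    by rewrite !expgS expg0 !groupE.
  split; first exact: (relconeM cT).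
  by apply: contra gK; apply: (convex_r cK); left.
Qed.

Lemma relcone_restrict (K : groupClosed G) :
  {subset L <= K} -> {subset K <= H} ->
  relcone K L [set x | T x /\ x \in K].
Proof.
move=> sLK sKH; split=> //=.
- by move=> x [].
- by move=> x [/(relcone_base cT)].
- move=> x xK; case: (relcone_tri cT (sKH _ xK)) => ?.
  + by constructor 1.
  + by constructor 2.
  + by constructor 3; rewrite gpredV.
- by move=> x y [Tx xK] [Ty yK]; split; [apply: (relconeM cT)|apply: gpredM].
- move=> k x kL [Tx xK]; split; [exact: (relcone_mull cT)|].
  by rewrite gpredM // sLK.
- move=> k x [Tx xK] kL; split; [exact: (relcone_mulr cT)|].
  by rewrite gpredM // sLK.
- move=> f g [Tg gK] Wf.
  have fK : f \in K by case: Wf => [[]|/sLK].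
  have [|n Tn] := relcone_conrad cT Tg (f := f).
    by case: Wf => [[]|]; [left|right].
  by exists n; rewrite !gpredM ?gpredV ?gpredXn.
Qed.

Lemma convex_refl : convex L.
Proof.
split=> [//||x y Wx Wy xyL]; first exact: (relcone_sub cT).
case: Wx => // Tx; have := relcone_base cT (wconeMr cT Tx Wy).
by rewrite xyL.
Qed.

Lemma dominated_refl h : T h -> dominated h h.
Proof.
by move=> Th; exists 2; rewrite expg2 !groupE; split; do ?apply: (relconeM cT).
Qed.

Lemma dominated_dom h x : T h -> dominated h x -> x \in H.
Proof.
move=> Th [n [/(relcone_dom cT) + _]].
by rewrite gpredMl // gpredXn // (relcone_dom cT).
Qed.

Lemma dominated_convex K h x :
  convex K -> T h -> h \in K -> dominated h x -> x \in K.
Proof.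
move=> cK Th hK hx; have xH := dominated_dom Th hx.
case: hx => n [T1 T2]; have [_ _ cvx] := cK.
have hnK : h ^+ n \in K by apply: gpredXn.
have [Tx|nTx] := pselect (T x).
  by apply: (cvx _ (x^-1 * h ^+ n)); [left|left|rewrite !groupE].
have Wx := wcone_total cT xH nTx.
have : h ^+ n * x \in K by apply: (cvx _ x^-1); [left| |rewrite !groupE].
by rewrite gpredMl.
Qed.

Lemma convex_dominated K h x :
  convex K -> T h -> h \notin K -> x \in K -> dominated h x.
Proof.
move=> cK Th hK xK; exists 1%N; rewrite expg1; split; first exact: (convex_mulr cK).
by apply: (convex_mull cK) => //; rewrite gpredV.
Qed.

Lemma convex_chain K K' : convex K -> convex K' ->
  {subset K <= K'} \/ {subset K' <= K}.
Proof.
move=> cK cK'; have [sK|nK] := pselect {subset K <= K'}; [by left|right].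
have [x /not_implyP[xK /negP xK']] := (existsNP _).2 nK.
have [sLK' _ _] := cK'; have [_ sKH _] := cK.
have [h [Th hK hK']] : exists h, [/\ T h, h \in K & h \notin K'].
  case: (relcone_tri cT (sKH _ xK)) => [Tx|/sLK'|Tx]; first by exists x.
    by rewrite (negPf xK').
  by exists x^-1; rewrite !gpredV.
by move=> y yK'; apply: (dominated_convex cK Th hK); apply: (convex_dominated cK').
Qed.

(** Closure under products is where the Conrad property enters: in a general
    left-order the elements between two powers of h need not form a subgroup. *)
Lemma dominated_group h : T h ->
  exists2 D : groupClosed G, convex D & forall x, (x \in D) <-> dominated h x.
Proof.
move=> Th; have [|x y [n [nx xn]] [m [my ym]]|x [n [nx xn]]|D hD] :=
  subgroup_exists (A := dominated h).
- by exists 1%N; rewrite expg1 invg1 mulg1 mul1g.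
- exists (m + m + n); split.
    have -> : h ^+ (m + m + n) * (x * y)
      = (h ^+ m * h ^+ m * (h ^+ n * x) * h ^- m) * (h ^+ m * y).
      by rewrite !expgnDr !groupE.
    by apply: (wconeMl cT) => //; apply: (relcone_conradVX cT) => //; left.
  have -> : (x * y)^-1 * h ^+ (m + m + n)
    = (y^-1 * h ^+ m) * (h ^- m * (x^-1 * h ^+ n) * h ^+ m * h ^+ m).
    by rewrite (addnC (m + m)) !expgnDr !groupE.
  by apply: (wconeMr cT) => //; apply: (relcone_conradX cT) => //; left.
- exists (n + n).+1; split.
    have -> : h ^+ (n + n).+1 * x^-1
      = h * (h ^+ n * h ^+ n * (x^-1 * h ^+ n) * h ^- n).
      by rewrite expgS !expgnDr !groupE.
    by apply: (wconeMr cT) => //; apply: (relcone_conradVX cT) => //; left.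
  have -> : x^-1^-1 * h ^+ (n + n).+1
    = (h ^- n * (h ^+ n * x) * h ^+ n * h ^+ n) * h.
    by rewrite expgSr !expgnDr !groupE.
  by apply: (wconeMl cT) => //; apply: (relcone_conradX cT) => //; left.
exists D => //; split.
- move=> x xL; apply/hD; apply: (convex_dominated convex_refl) => //.
  exact: (relcone_base cT).
- by move=> x /hD; apply: dominated_dom.
- move=> x y Wx Wy /hD[n [_ T2]]; apply/hD; exists n.+1; split.
    by apply: (wconeMr cT) => //; apply: (relconeX cT).
  have -> : x^-1 * h ^+ n.+1 = y * ((x * y)^-1 * h ^+ n) * h.
    by rewrite expgSr !groupE.
  by apply: (relconeM cT) => //; apply: (wconeMl cT).
Qed.

Definition jump (b : G) : set G :=
  [set x | exists2 V, convex V & b \notin V /\ x \in V].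

(** The largest convex subgroup that misses b; it exists because convex
    subgroups form a chain. *)
Lemma jump_group b : T b -> exists C : groupClosed G,
  [/\ convex C, b \notin C
    & forall V, convex V -> b \notin V -> {subset V <= C}].
Proof.
move=> Tb; have [|x y [V cV [bV xV]] [V' cV' [bV' yV']]|x [V cV [bV xV]]|C hC]
  := subgroup_exists (A := jump b).
- by exists L; [exact: convex_refl|split; [exact: (relcone_base cT)|exact: gpred1]].
- have [sV|sV] := convex_chain cV cV'.
    by exists V' => //; split=> //; apply: gpredM => //; apply: sV.
  by exists V => //; split=> //; apply: gpredM => //; apply: sV.
- by exists V => //; split=> //; rewrite gpredV.
exists C; split.
- split.
  + move=> x xL; apply/hC; exists L; first exact: convex_refl.
    by split=> //; apply: (relcone_base cT).
  + by move=> x /hC[V [_ sVH _] [_ xV]]; apply: sVH.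
  + move=> x y Wx Wy /hC[V cV [bV xyV]]; apply/hC; exists V => //; split=> //.
    by have [_ _] := cV; apply; last exact: xyV.
- by apply/negP => /hC[V _ [/negP]].
- by move=> V cV bV x xV; apply/hC; exists V.
Qed.

End Convex.

(** * Hoelder's theorem *)

Definition archimedean (G : groupType) (H : groupClosed G) (T : set G) : Prop :=
  forall f y, T f -> y \in H ->
    exists n : nat, T (f ^+ n * y) /\ T (y^-1 * f ^+ n).

Section Hoelder.
Variables (G : groupType) (H K : groupClosed G) (T : set G).
Hypotheses (cT : relcone H K T) (aT : archimedean H T).

(** If g^-1 * f * g <= 1, so are all the g^-1 * f ^+ n * g; this bounds the
    powers of f by g or by g^-1, whichever is positive. *)
Lemma archimedean_conj f g : T f -> g \in H -> T (f ^ g).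
Proof.
rewrite /conjg mulgA => Tf gH; apply: contrapT => nT; have fH := relcone_dom cT Tf.
have := wcone_total cT _ nT; rewrite !gpredM ?gpredV // !groupE => /(_ isT) W1.
have Wn n : wcone K T (g^-1 * f ^- n * g).
  have := wconeX cT n W1; congr (wcone K T).
  elim: n => [|n IHn]; first by rewrite !expg0 !groupE.
  by rewrite expgS IHn expgSr !groupE.
have [n [T1 T2]] := aT Tf gH.
have [Tg|nTg] := pselect (T g).
  have /relcone_asym := T2; apply; first exact: cT.
  have -> : (g^-1 * f ^+ n)^-1 = g * (g^-1 * f ^- n * g) by rewrite !groupE.
  by left; apply: (wconeMr cT).
have Wg := wcone_total cT gH nTg.
have /relcone_asym := T1; apply; first exact: cT.
have -> : (f ^+ n * g)^-1 = (g^-1 * f ^- n * g) * g^-1 by rewrite !groupE.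
exact: (wconeM cT).
Qed.

(** K is the complement of the conjugation-invariant set of positive and
    negative elements. *)
Lemma archimedean_normal : normal_in K H.
Proof.
split=> [|x y xH yK]; first exact: (relcone_sub cT).
have yH := relcone_sub cT yK.
have conjT z : T (z ^ x) -> T z.
  move=> Tz; have xVH : x^-1 \in H by rewrite gpredV.
  by have := archimedean_conj Tz xVH; rewrite conjgK.
have [/conjT/(relcone_base cT)||] := relcone_tri cT (gpredJ yH xH) => //.
- by rewrite yK.
- by rewrite -conjVg => /conjT/(relcone_base cT); rewrite gpredV yK.
Qed.

Lemma archimedean_wcone_conj f g : wcone K T f -> g \in H -> wcone K T (f ^ g).
Proof.
case=> [Tf|fK] gH; first by left; apply: archimedean_conj.
by right; apply: archimedean_normal.2.
Qed.

Lemma archimedean_floor d x : T d -> x \in H -> wcone K T x ->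
  exists m : nat, wcone K T (d ^- m * x) /\ T (x^-1 * d ^+ m.+1).
Proof.
move=> Td xH Wx; have [n [_ Tn]] := aT Td xH.
have ex : exists n, `[< T (x^-1 * d ^+ n) >] by exists n; apply/asboolP.
case: (ex_minnP ex) => -[|m] /asboolP Tm minm.
  by case: (relcone_asym cT Tm); rewrite expg0 mulg1 invgK.
exists m; split=> //.
have -> : d ^- m * x = (x^-1 * d ^+ m)^-1 by rewrite !groupE.
apply: (wcone_total cT).
  by rewrite gpredM ?gpredV // gpredXn // (relcone_dom cT).
by move=> Tm'; have /minm := asboolT Tm'; rewrite ltnn.
Qed.

(** Suppose c := [~ x, y] > 1. If some d > 1 has d^2 <= c, then bracketing x
    and y between consecutive powers of d shows x * y < y * x * d^2, a
    contradiction. If not, c is the least positive element, so that x and y are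
    powers of c modulo K and commute modulo K. *)
Lemma archimedean_commg_pos x y : T x -> T y -> ~ T [~ x, y].
Proof.
set c := [~ x, y] => Tx Ty Tc.
have [xH yH cH] : [/\ x \in H, y \in H & c \in H].
  by split; apply: (relcone_dom cT).
have Wx : wcone K T x by left.
have Wy : wcone K T y by left.
have [[d Td Wd]|nd] := pselect (exists2 d, T d & wcone K T (d^-1 * d^-1 * c)).
  have dH := relcone_dom cT Td.
  have [m [Wm Tm]] := archimedean_floor Td xH Wx.
  have [n [Wn Tn]] := archimedean_floor Td yH Wy.
  set w := (d ^- n * y) ^ (d ^+ m) * (d ^- m * x).
  have Ww : wcone K T w.
    apply: (wconeM cT) => //; apply: archimedean_wcone_conj => //.
    exact: gpredXn.
  set t := (x^-1 * d ^+ m.+1) ^ y * (y^-1 * d ^+ n.+1).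
  have Tt : T t by apply: (relconeM cT) => //; apply: archimedean_conj.
  have Tcd : T (t * w ^ (d * d)).
    apply: (wconeMr cT) => //; apply: archimedean_wcone_conj => //.
    exact: gpredM.
  apply: (relcone_asym cT Tcd).
  suff -> : (t * w ^ (d * d))^-1 = d^-1 * d^-1 * c by [].
  apply: invg_inj; rewrite /t /w /c /commg /conjg !groupE.
  have dmn : d ^+ m.+1 * d ^+ n.+1 = d ^+ n * d ^+ m * d * d.
    by rewrite -!expgnDr -!expgSr addSn addnS addnC.
  by rewrite -(mulgA _ (d ^+ m.+1)) dmn !groupE.
have minc s : T s -> wcone K T (c^-1 * s).
  move=> Ts; have sH := relcone_dom cT Ts.
  have -> : c^-1 * s = (s^-1 * c)^-1 by rewrite !groupE.
  apply: (wcone_total cT); first by rewrite gpredM ?gpredV.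
  move=> Ts'; apply: nd.
  have [Tss|nTss] := pselect (T ((s^-1 * c)^-1 * s)).
    exists (s^-1 * c) => //; left.
    by have := archimedean_conj Tss (relcone_dom cT Ts'); rewrite /conjg !groupE.
  exists s => //; have := wcone_total cT _ nTss; rewrite !groupE; apply.
  by rewrite !gpredM ?gpredV.
have pow z : T z -> exists m : nat, c ^- m * z \in K.
  move=> Tz; have [|m [Wm Tm]] := archimedean_floor Tc (relcone_dom cT Tz).
    by left.
  exists m; case: Wm => // /minc Wm.
  case: (relcone_asym cT Tm).
  suff -> : (z^-1 * c ^+ m.+1)^-1 = c^-1 * (c ^- m * z) by [].
  by rewrite expgSr !groupE.
have [[m xm] [n yn]] := (pow _ Tx, pow _ Ty).
have [_ nK] := archimedean_normal.
have := relcone_base cT Tc; rewrite /c.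
have -> : [~ x, y] = (c ^- m * x)^-1 * ((c ^- n * y)^-1 ^ (c ^+ m))
   * (c ^- m * x) ^ (c ^+ n) * (c ^- n * y).
  rewrite /commg /conjg !groupE.
  have cmn : c ^+ n * c ^+ m = c ^+ m * c ^+ n by rewrite -!expgnDr addnC.
  by rewrite -(mulgA _ (c ^+ n) (c ^+ m)) cmn !groupE.
have cX k : c ^+ k \in H by apply: gpredXn.
apply/negP/negPn; apply: gpredM => //; apply: gpredM; last exact: nK.
by apply: gpredM; rewrite ?gpredV //; apply: nK; rewrite ?gpredV.
Qed.

Lemma archimedean_abelian : abelian_mod K H.
Proof.
have [sKH nK] := archimedean_normal.
have sym x y : [~ x, y] \in K -> [~ y, x] \in K by rewrite -invgR gpredV.
have K1 x y : x \in K -> y \in H -> [~ x, y] \in K.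
  by move=> xK yH; rewrite /commg gpredM ?gpredV ?nK.
have inv x y : x \in H -> [~ x^-1, y] \in K -> [~ x, y] \in K.
  move=> xH xy; have -> : [~ x, y] = [~ x^-1, y]^-1 ^ x.
    by rewrite /commg /conjg !groupE.
  by rewrite nK ?gpredV.
have pos x y : T x -> T y -> [~ x, y] \in K.
  move=> Tx Ty; have cH : [~ x, y] \in H by apply: gpredR; apply: (relcone_dom cT).
  case: (relcone_tri cT cH) => // [/(archimedean_commg_pos Tx Ty)//|].
  by rewrite invgR => /(archimedean_commg_pos Ty Tx).
move=> x y xH yH.
have posl z : T z -> [~ z, y] \in K.
  move=> Tz; have zH := relcone_dom cT Tz.
  case: (relcone_tri cT yH) => [Ty|yK|Ty]; first exact: pos.
    by apply: sym; apply: K1.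
  by apply: sym; apply: inv => //; apply: pos.
case: (relcone_tri cT xH) => [|xK|Tx]; [exact: posl|exact: K1|].
by apply: inv => //; apply: posl.
Qed.

End Hoelder.

Section Jump.
Variables (G : groupType) (H L : groupClosed G) (T : set G).
Hypothesis cT : relcone H L T.

(** Every positive element of D outside C dominates b, since C contains
    every convex subgroup that misses b; hence D / C is archimedean. *)
Lemma jump_abelian b (D C : groupClosed G) : T b ->
  convex H L T D -> (forall x, (x \in D) <-> dominated T b x) ->
  convex H L T C -> b \notin C ->
  (forall V, convex H L T V -> b \notin V -> {subset V <= C}) ->
  normal_in C D /\ abelian_mod C D.
Proof.
move=> Tb cD hD cC bC maxC; pose T' := [set x | (T x /\ x \in D) /\ x \notin C].
have [sLD sDH cvD] := cD; have [sLC sCH cvC] := cC.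
have sCD : {subset C <= D}.
  by move=> x xC; apply/hD; apply: (convex_dominated cT cC).
have cT' : relcone D C T'.
  apply: (convex_top (relcone_restrict cT sLD sDH)).
  split=> // x y Wx Wy; apply: cvC.
    by case: Wx => [[]|]; [left|right].
  by case: Wy => [[]|]; [left|right].
have aT' : archimedean D T'.
  move=> f y [[Tf fD] fC] yD.
  have [E cE hE] := dominated_group cT Tf.
  have bE : b \in E.
    apply/negP => bE; case/negP: fC; apply: (maxC E) => //; first exact/negP.
    by apply/hE; apply: (dominated_refl cT).
  have /hE[n [T1 T2]] : y \in E.
    by apply: (dominated_convex cT cE Tb bE); apply/hD.
  have W z : T z -> z \in D -> wcone C T' z.
    by move=> Tz zD; have [|zC] := boolP (z \in C); [right|left].
  have fnD : f ^+ n \in D by apply: gpredXn.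
  exists n.+1; split.
    by rewrite expgS -mulgA; apply: (wconeMr cT'); [|apply: W; rewrite ?gpredM].
  rewrite expgSr mulgA; apply: (wconeMl cT'); last by [].
  by apply: W; rewrite ?gpredM ?gpredV.
by split; [apply: archimedean_normal cT' aT'|apply: archimedean_abelian cT' aT'].
Qed.

End Jump.

(** * Orders on torsion-free Abelian quotients *)

Lemma abelian_mod_conj (G : groupType) (N H : groupClosed G) x y :
  {subset N <= H} -> abelian_mod N H -> x \in N -> y \in H -> x ^ y \in N.
Proof.
move=> sNH aN xN yH; have -> : x ^ y = x * [~ x, y] by rewrite commgEl mulVKg.
by rewrite gpredM // aN // sNH.
Qed.

Section Extension.
Variables (G : groupType) (N H : groupClosed G).
Hypotheses (sNH : {subset N <= H}) (aN : abelian_mod N H).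
Hypothesis tN : torsion_free_mod N H.

(** The nonnegative cone of a partial order on H / N, as a subset of H. *)
Record precone (M : set G) : Prop := PreCone {
  precone_dom : forall x, M x -> x \in H;
  precone_base : forall x, x \in N -> M x;
  preconeM : forall x y, M x -> M y -> M (x * y);
  precone_anti : forall x, M x -> M x^-1 -> x \in N }.

Lemma precone_conj M x y : precone M -> M x -> y \in H -> M (x ^ y).
Proof.
move=> cM Mx yH; have -> : x ^ y = x * [~ x, y] by rewrite commgEl mulVKg.
apply: (preconeM cM) => //; apply: (precone_base cM); apply: aN => //.
exact: (precone_dom cM).
Qed.

Lemma preconeX M x n : precone M -> M x -> M (x ^+ n).
Proof.
move=> cM Mx; elim: n => [|n IHn]; last by rewrite expgS; apply: (preconeM cM).
exact/(precone_base cM)/gpred1.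
Qed.

(** Zorn's lemma is applied to the sets X whose union with M0 is a precone, so
    that the empty chain causes no trouble. *)
Lemma precone_maximal M0 : precone M0 -> exists2 M, precone M & M0 `<=` M /\
  forall M', precone M' -> M `<=` M' -> M' `<=` M.
Proof.
move=> cM0; pose P X := precone (X `|` M0).
have [|A [PA maxA]] := @Zorn_bigcup _ P.
  move=> F FP totF; rewrite /P; set U := _ `|` M0.
  have two x y : U x -> U y -> exists Z, [/\ precone Z, Z `<=` U, Z x & Z y].
    have sub X : F X -> X `|` M0 `<=` U.
      by move=> FX z [Xz|]; [left; exists X|right].
    move=> [[X FX Xx]|Mx] [[Y FY Yy]|My].
    - have [sXY|sYX] := totF _ _ FX FY.
        exists (Y `|` M0); split; [exact: FP|exact: sub|by left; apply: sXY|by left].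
      exists (X `|` M0); split; [exact: FP|exact: sub|by left|by left; apply: sYX].
    - exists (X `|` M0); split; [exact: FP|exact: sub|by left|by right].
    - exists (Y `|` M0); split; [exact: FP|exact: sub|by right|by left].
    - by exists M0; split => // z; right.
  split.
  - by move=> x Ux; have [Z [/precone_dom + _ Zx _]] := two _ _ Ux Ux; apply.
  - by move=> x /(precone_base cM0); right.
  - move=> x y Ux Uy; have [Z [cZ sZ Zx Zy]] := two _ _ Ux Uy.
    by apply/sZ/(preconeM cZ).
  - move=> x Ux Uy; have [Z [cZ sZ Zx Zy]] := two _ _ Ux Uy.
    exact: (precone_anti cZ).
exists (A `|` M0) => //; split; first by move=> x; right.
move=> M' cM' sM'; have [sA|nsA] := pselect (M' `<=` A).
  by move=> x /sA; left.
have sAM' : A `<=` M' by move=> x Ax; apply: sM'; left.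
case: (maxA M') => //; rewrite /P setUidl // => x Mx; apply: sM'; right.
exact: Mx.
Qed.

Definition adjoin (M : set G) (x : G) : set G :=
  [set y | exists n, M (y * x ^- n)].

Lemma adjoinM M x y z m n : precone M -> x \in H ->
  M (y * x ^- m) -> M (z * x ^- n) -> M (y * z * x ^- (m + n)).
Proof.
move=> cM xH My Mz.
have -> : y * z * x ^- (m + n) = (y * x ^- m) * (z * x ^- n) ^ (x ^- m).
  by rewrite /conjg expgnDr !groupE.
apply: (preconeM cM) => //; apply: precone_conj => //.
by rewrite gpredV gpredXn.
Qed.

Lemma adjoin_precone M x : precone M -> x \in H ->
  precone (adjoin M x) \/ exists2 j, (0 < j)%N & M (x ^- j).
Proof.
move=> cM xH; have [|nj] := pselect (exists2 j, (0 < j)%N & M (x ^- j)); first by right.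
left; split.
- move=> y [n /(precone_dom cM)].
  by rewrite gpredMr // gpredV gpredXn.
- by move=> y yN; exists 0%N; rewrite expg0 invg1 mulg1; apply: (precone_base cM).
- by move=> y z [m My] [n Mz]; exists (m + n)%N; apply: adjoinM.
- move=> y [m My] [n Mz]; have := adjoinM cM xH My Mz; rewrite mulgV mul1g => Mx.
  have [|mn0] := posnP (m + n); last by case: nj; exists (m + n)%N.
  move/eqP; rewrite addn_eq0 => /andP[/eqP m0 /eqP n0].
  by move: My Mz; rewrite m0 n0 expg0 invg1 !mulg1; apply: (precone_anti cM).
Qed.

(** A maximal precone M is total: if neither x nor its inverse can be adjoined,
    then negative powers of both lie in M, whence a power of x lies in N. *)
Lemma precone_extend M0 : precone M0 ->
  exists2 T, relcone H N T & forall x, M0 x -> T x \/ x \in N.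
Proof.
move=> /precone_maximal[M cM [sM0 maxM]].
have memP x : x \in H -> M x \/ exists2 j, (0 < j)%N & M (x ^- j).
  move=> xH; have [cA|] := adjoin_precone cM xH; last by right.
  left; apply: (maxM _ cA).
    by move=> y My; exists 0%N; rewrite expg0 invg1 mulg1.
  by exists 1%N; rewrite expg1 mulgV; apply/(precone_base cM)/gpred1.
have tot x : x \in H -> M x \/ M x^-1.
  move=> xH; have [|[j j0 Mj]] := memP _ xH; first by left.
  have xVH : x^-1 \in H by rewrite gpredV.
  have [|[i i0]] := memP _ xVH; first by right.
  rewrite expVgn invgK => Mi; left; apply: (precone_base cM).
  apply: (tN (n := (i * j)%N)) => //.
    by rewrite muln_gt0 i0.
  apply: (precone_anti cM); first by rewrite expgnA; apply: preconeX.
  by rewrite mulnC expgnA -expVgn; apply: preconeX.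
have MT x y : M x -> M y -> x * y \in N -> x \in N.
  move=> Mx My xyN; apply: (precone_anti cM) => //.
  have -> : x^-1 = y * (x * y)^-1 by rewrite !groupE.
  by apply: (preconeM cM) => //; apply: (precone_base cM); rewrite gpredV.
exists [set x | M x /\ x \notin N] => /=; last first.
  by move=> x /sM0 Mx; have [|] := boolP (x \in N); [right|left].
split=> //=.
- by move=> x [/(precone_dom cM)].
- by move=> x [].
- move=> x xH; have [xN|xN] := boolP (x \in N); first by constructor 2.
  by case: (tot _ xH) => ?; [constructor 1|constructor 3; rewrite gpredV].
- move=> x y [Mx xN] [My yN]; split; first exact: (preconeM cM).
  by apply: contra xN; apply: MT.
- move=> k x kN [Mx xN]; split; last by rewrite gpredMl.
  by apply: (preconeM cM) => //; apply: (precone_base cM).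
- move=> x k [Mx xN] kN; split; last by rewrite gpredMr.
  by apply: (preconeM cM) => //; apply: (precone_base cM).
- move=> f g [Mg gN] Wf; have Mf : M f by case: Wf => [[]|/(precone_base cM)].
  have Mfg : M (f ^ g) by apply: precone_conj => //; apply: (precone_dom cM).
  exists 2; rewrite expg2 !mulgA -(mulgA g^-1 f g); split.
    exact: (preconeM cM).
  apply: contra gN => fgN; have fN := MT _ _ Mfg Mg fgN.
  by rewrite -(gpredMl g fN).
Qed.

Lemma relcone_exists : exists T, relcone H N T.
Proof.
have [|T cT _] := @precone_extend [set x | x \in N]; last by exists T.
by split => //= x y; apply: gpredM.
Qed.

End Extension.

Section IntPower.
Variable G : groupType.
Local Open Scope ring_scope.

Lemma expgzS (x : G) a : expgz x (a + 1) = (expgz x a * x)%g.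
Proof.
case: a => [n|[|n]]; first by rewrite /= addn1 expgSr.
  by rewrite [RHS]/= expg1 mulVg.
have -> : Negz n.+1 + 1 = Negz n by rewrite !NegzE; lia.
by rewrite [RHS]/= (expgS x n.+1) invgM mulgVK.
Qed.

Lemma expgzD (x : G) a b : expgz x (a + b) = (expgz x a * expgz x b)%g.
Proof.
have nat_case c (n : nat) : expgz x (c + n%:Z) = (expgz x c * x ^+ n)%g.
  elim: n => [|n IHn]; first by rewrite GRing.addr0 expg0 mulg1.
  by rewrite -addn1 PoszD GRing.addrA expgzS IHn addn1 expgSr mulgA.
case: b => n; first exact: nat_case.
rewrite NegzE [RHS]/=.
by have := nat_case (a - n.+1%:Z) n.+1; rewrite GRing.subrK => ->; rewrite mulgK.
Qed.

Lemma expgz_mem (K : groupClosed G) x a : x \in K -> expgz x a \in K.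
Proof. by move=> xK; case: a => n /=; rewrite ?gpredV gpredXn. Qed.

End IntPower.

Definition cones (G : groupType) (H L : groupClosed G) : set (set G) :=
  [set T | relcone H L T].

Lemma injective_infinite (T : Type) (A : set T) (f : nat -> T) :
  (forall k, A (f k)) -> (forall k l, (k < l)%N -> f k <> f l) ->
  ~ finite_set A.
Proof.
move=> fA fneq finA; apply: infinite_nat.
have finj : {in [set: nat] &, injective f}.
  move=> k l _ _ efkl; case: (ltngtP k l) => // /fneq[]//.
rewrite -(eq_finite_set (inj_card_eq finj)); apply: sub_finite_set finA.
by move=> _ [k _ <-].
Qed.

Definition independent_mod (G : groupType) (N : groupClosed G) (x y : G) :=
  forall a b : int, expgz x a * expgz y b \in N -> a = 0%R /\ b = 0%R.

Section TwoGenerators.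
Variables (G : groupType) (N H L : groupClosed G) (x y : G).
Hypotheses (sNH : {subset N <= H}) (aN : abelian_mod N H).
Hypothesis tN : torsion_free_mod N H.
Hypotheses (xH : x \in H) (yH : y \in H) (indep : independent_mod N x y).

Let e (a b : int) : G := expgz x a * expgz y b.

Let eH a b : e a b \in H.
Proof. by rewrite gpredM // expgz_mem. Qed.

Let eM a b c d k l : k \in N -> l \in N ->
  exists2 n, n \in N & (e a b * k) * (e c d * l) = e (a + c)%R (b + d)%R * n.
Proof.
move=> kN lN.
exists ([~ expgz y b, expgz x c] ^ expgz y d * (k ^ e c d * l)).
  have nN := @abelian_mod_conj _ _ _ _ _ sNH aN.
  apply: gpredM; first by apply: nN; [apply: aN|]; apply: expgz_mem.
  by apply: gpredM => //; apply: nN.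
by rewrite /e /commg /conjg !expgzD !groupE.
Qed.

(** The elements whose coordinates (a, b) modulo N with respect to x and y lie
    in the cone spanned by (- k, 1) and (k + 1, - 1). *)
Let slope (k : nat) : set G := [set z | exists (a b : int) n,
  [/\ (0 <= a + k%:Z * b)%R, (0 <= a + k.+1%:Z * b)%R, n \in N & z = e a b * n]].

Let slope_precone k : precone N H (slope k).
Proof.
split.
- by move=> z [a [b [n [_ _ nN ->]]]]; rewrite gpredM ?eH ?sNH.
- by move=> z zN; exists 0%R, 0%R, z; split; rewrite ?GRing.mulr0 // /e !groupE.
- move=> _ _ [a [b [n [h1 h2 nN ->]]]] [c [d [m [h3 h4 mN ->]]]].
  have [p pN ->] := eM a b c d nN mN.
  by exists (a + c)%R, (b + d)%R, p; split=> //; lia.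
- move=> z [a [b [n [h1 h2 nN ez]]]] [c [d [m [h3 h4 mN ezV]]]].
  have [p pN] := eM a b c d nN mN; rewrite -ez -ezV mulgV => e1.
  have /indep[ac bd] : e (a + c)%R (b + d)%R \in N.
    by rewrite -(mulgK p (e _ _)) -e1 mul1g gpredV.
  have [b0 a0] : b = 0%R /\ a = 0%R.
    have [ca db] : c = (- a)%R /\ d = (- b)%R by lia.
    have b0 : b = 0%R by rewrite ca db in h3 h4; lia.
    by split=> //; rewrite ca db b0 in h1 h3; lia.
  by rewrite ez a0 b0 /e !groupE.
Qed.

(** In an order that extends slope k, the element y lies strictly between x ^+ k
    and x ^+ k.+1, hence these orders are pairwise distinct. *)
Lemma two_generators_infinite Q : relcone N L Q -> ~ finite_set (cones H L).
Proof.
move=> cQ.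
have ext k : exists T, relcone H N T /\ forall z, slope k z -> T z \/ z \in N.
  by have [T cT sT] := precone_extend sNH aN tN (slope_precone k); exists T.
have [T hT] := choice ext.
apply: (@injective_infinite _ _ (fun k => Q `|` T k)) => [k|k l ltkl eT].
  by apply: relcone_lex cQ; apply: (hT k).1.
have [[cTk sTk] [cTl sTl]] := (hT k, hT l).
pose z := e (- k.+1%:Z)%R 1%R; have zN : z \notin N.
  by apply/negP => /indep[].
have N1 : 1 \in N by apply: gpred1.
have [w wN zw] := eM (- k.+1%:Z)%R 1%R (k.+1%:Z)%R (- 1)%R N1 N1.
have zVk : T k (z^-1).
  have [|//|] := sTk (z^-1); last by rewrite gpredV (negPf zN).
  exists (k.+1%:Z)%R, (- 1)%R, w^-1; split; [lia|lia|by rewrite gpredV|].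
  move: zw; rewrite GRing.addNr GRing.addrN !mulg1 -/z => zw.
  by rewrite -(mulKg z (e _ _)) zw /e !groupE.
have zl : T l z.
  have [|//|] := sTl z; last by rewrite (negPf zN).
  by exists (- k.+1%:Z)%R, 1%R, 1; split; rewrite ?gpred1 ?mulg1 //; lia.
have : (Q `|` T l) z by right.
rewrite -eT => -[/(relcone_dom cQ)|Tz]; first by rewrite (negPf zN).
by apply: (relcone_asym cTk Tz); left.
Qed.

End TwoGenerators.

(** * Rational steps *)

Section Cosets.
Variables (G : groupType) (N H : groupClosed G).
Hypothesis nNH : normal_in N H.
Implicit Types x y : G.

Let inH x : x \in H -> x \in normaliser N.
Proof. exact: normal_in_normaliser nNH x. Qed.

Lemma coset1 : coset N 1 = 1.
Proof.
have n1 := inH (gpred1 (s := H)).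
by apply: (mulgI (coset N 1)); rewrite -cosetM // !mulg1.
Qed.

Lemma coset_eq1 x : x \in H -> coset N x = 1 <-> x \in N.
Proof.
move=> xH; rewrite -coset1; split.
  by move/esym/coset_eqP; rewrite invg1 mul1g; apply; apply: inH; rewrite ?gpred1.
move=> xN; apply/esym/coset_eqP; rewrite ?inH ?gpred1 //.
by rewrite invg1 mul1g.
Qed.

Lemma cosetX x n : x \in H -> coset N x ^+ n = coset N (x ^+ n).
Proof.
move=> xH; elim: n => [|n IHn]; first by rewrite !expg0 coset1.
by rewrite !expgS IHn cosetM // inH // gpredXn.
Qed.

Lemma coset_expgz x a : x \in H -> expgz (coset N x) a = coset N (expgz x a).
Proof.
move=> xH; case: a => n /=; first exact: cosetX.
rewrite cosetX //; apply: mulg1_eq.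
by rewrite -cosetM ?inH ?gpredV ?gpredXn // mulgV coset1.
Qed.

Lemma quotient_coset x : x \in H -> quotient N H (coset N x).
Proof. by move=> xH; exists x => //; split=> //; apply: inH. Qed.

Lemma abelian_quotientP : abelian_set (quotient N H) <-> abelian_mod N H.
Proof.
have commE x y : x \in H -> y \in H ->
    commute (coset N x) (coset N y) <-> [~ x, y] \in N.
  move=> xH yH; rewrite /commute -!cosetM ?inH //.
  have -> : [~ x, y] = (y * x)^-1 * (x * y) by rewrite /commg /conjg !groupE.
  have P := coset_eqP (inH (gpredM _ _ yH xH)) (inH (gpredM _ _ xH yH)).
  by split=> [/esym/P//|/P/esym].
split=> [ab x y xH yH|ab _ _ [x [xH _] <-] [y [yH _] <-]]; last exact/commE/ab.
by apply/commE => //; apply: ab; apply: quotient_coset.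
Qed.

Lemma torsion_free_quotientP :
  torsion_free (quotient N H) <-> torsion_free_mod N H.
Proof.
have xnH x n : x \in H -> x ^+ n \in H by apply: gpredXn.
split=> [tf x n xH n0 xN|tf _ n [x [xH _] <-] n0].
  apply/(coset_eq1 xH); apply: (tf _ n) => //; first exact: quotient_coset.
  by rewrite cosetX //; apply/(coset_eq1 (xnH _ n xH)).
rewrite cosetX // => /(coset_eq1 (xnH _ n xH)) xnN.
by apply/(coset_eq1 xH); apply: (tf _ n).
Qed.

Lemma independent_pairP x y : x \in H -> y \in H ->
  independent (fun i : 'I_2 => if i == ord0 then coset N x else coset N y)
  <-> independent_mod N x y.
Proof.
move=> xH yH; have prodE (k : 'I_2 -> int) :
    \prod_(i < 2) expgz (if i == ord0 then coset N x else coset N y) (k i) = 1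
    <-> expgz x (k ord0) * expgz y (k ord_max) \in N.
  rewrite !big_ord_recl big_ord0 mulg1 /=.
  have -> : lift ord0 ord0 = ord_max :> 'I_2 by apply: val_inj.
  rewrite !coset_expgz // -cosetM ?inH ?expgz_mem //.
  by apply: coset_eq1; rewrite gpredM // expgz_mem.
split=> [ind a b abN|ind k /prodE/ind[k0 k1] i].
  pose k (i : 'I_2) := if i == ord0 then a else b.
  have /ind hk : \prod_(i < 2)
      expgz (if i == ord0 then coset N x else coset N y) (k i) = 1.
    exact/prodE.
  by split; [have := hk ord0|have := hk ord_max].
have [->//|i0] := eqVneq i ord0; have -> // : i = ord_max.
by case: i i0 => [[|[|]]] // p _; apply: val_inj.
Qed.

End Cosets.

(** H / N is torsion-free Abelian of rank one, in terms of elements of H. *)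
Record rational_step (G : groupType) (N H : groupClosed G) : Prop :=
    RationalStep {
  step_normal : normal_in N H;
  step_abelian : abelian_mod N H;
  step_torsion : torsion_free_mod N H;
  step_proper : exists2 x, x \in H & x \notin N;
  step_rank : {in H &, forall x y, ~ independent_mod N x y} }.

Lemma expgz_torsion (G : groupType) (N H : groupClosed G) x a :
  torsion_free_mod N H -> x \in H -> x \notin N -> expgz x a \in N -> a = 0%R.
Proof.
move=> tN xH /negP xN; case: a => [[//|n]|n] /=; rewrite ?gpredV => /tN xN';
by case: xN; apply: xN'.
Qed.

Lemma rational_stepP (G : groupType) (N H : groupClosed G) :
  normal_in N H /\ torsion_free_abelian_rank1 (quotient N H)
  <-> rational_step N H.
Proof.
split=> [[nNH [/(abelian_quotientP nNH) aN /(torsion_free_quotientP nNH) tN]]|].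
  move=> [[e eH ind] rk]; split=> //.
    have [x [xH _] ex] := eH ord0; exists x => //; apply/negP => xN.
    have : \prod_(i < 1) expgz (e i) 1 = 1.
      by rewrite big_ord_recl big_ord0 mulg1 -ex /=; apply/(coset_eq1 nNH).
    by move=> /(ind (fun=> 1%R))/(_ ord0).
  move=> x y xH yH /(independent_pairP nNH xH yH); apply: rk => i.
  by case: ifP => _; apply: quotient_coset.
move=> [nNH aN tN [x xH xN] rk]; split=> //.
split; [exact/abelian_quotientP|exact/torsion_free_quotientP|split].
  exists (fun=> coset N x) => [_|k]; first exact: quotient_coset.
  rewrite big_ord_recl big_ord0 mulg1 (coset_expgz nNH) // => kx i.
  rewrite (ord1 i); apply: (expgz_torsion tN xH xN).
  by apply/(coset_eq1 nNH) => //; apply: expgz_mem.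
move=> e eH; have [y [yH _] ey] := eH ord0; have [z [zH _] ez] := eH ord_max.
have -> : e = fun i : 'I_2 => if i == ord0 then coset N y else coset N z.
  apply/funext => i; case: ifP => [/eqP->//|i0]; rewrite ez; congr e.
  by case: i i0 => [[|[|]]] // p _; apply: val_inj.
by move/(independent_pairP nNH yH zH); apply: rk.
Qed.

(** * The top step of a group with finitely many orders *)

Lemma finite_maximal (T : Type) (F : set (set T)) : finite_set F -> F !=set0 ->
  exists2 M, F M & forall X, F X -> M `<=` X -> X `<=` M.
Proof.
move=> /finite_seqP[s ->]; elim: s => [|A s IHs] [X /= Xs]; first by [].
have [->|/eqP s0] := pselect (s = [::]).
  exists A => /=; first by rewrite inE eqxx.
  by move=> Y; rewrite inE => /eqP->.
have [|M Ms maxM] := IHs.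
  by case: s s0 {IHs Xs} => // B s _; exists B; rewrite /= inE eqxx.
have [MA|nMA] := pselect (M `<=` A).
  exists A => /=; first by rewrite inE eqxx.
  move=> Y; rewrite inE => /orP[/eqP->//|Ys AY].
  by apply: (subset_trans _ MA); apply: maxM => //; apply: (subset_trans MA).
exists M => /=; first by rewrite inE; apply/orP; right.
by move=> Y; rewrite inE => /orP[/eqP->//|Ys]; apply: maxM.
Qed.

Section TopStep.
Variables (G : groupType) (H L : groupClosed G) (T : set G).
Hypotheses (cT : relcone H L T) (finH : finite_set (cones H L)).

(** Reversing the order inside a convex subgroup gives another Conradian order,
    from which the subgroup can be read off. *)
Lemma finite_dominated :
  finite_set [set D | exists2 b, T b & D = dominated T b].
Proof.
set F := [set D | _].
pose flip (D : set G) : set G :=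
  [set x | T x^-1 /\ D x^-1] `|` [set x | T x /\ ~ D x].
have flipE D x : T x -> D x <-> ~ flip D x.
  move=> Tx; split=> [Dx [[TxV _]|[_]] //|nf].
    by apply: (relcone_asym cT Tx); left.
  by apply: contrapT => nDx; apply: nf; right.
have domE b b' : T b -> T b' ->
    (forall x, T x -> dominated T b x <-> dominated T b' x) ->
    dominated T b `<=` dominated T b'.
  move=> Tb Tb' e x; have [D [sLD sDH _] hD] := dominated_group cT Tb.
  have [D' [sLD' _ _] hD'] := dominated_group cT Tb'.
  move/hD => xD; apply/hD'; case: (relcone_tri cT (sDH _ xD)) => [Tx|/sLD'//|Tx].
    by apply/hD'/e => //; apply/hD.
  by rewrite -gpredV; apply/hD'/e => //; apply/hD; rewrite gpredV.
have finj : {in F &, injective flip}.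
  move=> _ _ /set_mem[b Tb ->] /set_mem[b' Tb' ->] e.
  have eD x : T x -> dominated T b x <-> dominated T b' x.
    move=> Tx; have h1 := flipE (dominated T b) _ Tx.
    have h2 := flipE (dominated T b') _ Tx.
    by rewrite h1 h2 e.
  apply/seteqP; split; apply: domE => // x Tx.
  by symmetry; apply: eD.
rewrite -(eq_finite_set (inj_card_eq finj)); apply: sub_finite_set finH.
move=> _ [_ [b Tb ->] <-]; have [D cD hD] := dominated_group cT Tb.
have [sLD sDH _] := cD.
have := relcone_lex (convex_top cT cD) (relcone_opp (relcone_restrict cT sLD sDH)).
congr (relcone H L _); apply/seteqP; split=> x.
  case=> [[Tx /hD xD]|[Tx /negP xD]]; [by left|right; split=> // /hD].
  by move/xD.
case=> [[Tx /hD xD]|[Tx xD]]; [by left|right; split=> //].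
by apply/negP => /hD/xD.
Qed.

(** A maximal set of the form dominated T b is everything: a positive z is
    dominated by b * z, which also dominates b. *)
Lemma finite_dominated_top : T !=set0 ->
  exists2 b, T b & forall y, y \in H -> dominated T b y.
Proof.
move=> [t Tt].
have [|_ [b Tb ->] maxb] := finite_maximal finite_dominated.
  by exists (dominated T t); exists t.
exists b => // y yH.
have [D cD hD] := dominated_group cT Tb; have [sLD _ _] := cD.
have pos z : T z -> dominated T b z.
  move=> Tz; have Tbz : T (b * z) by apply: (relconeM cT).
  have [E cE hE] := dominated_group cT Tbz.
  have bzE : b * z \in E by apply/hE; apply: (dominated_refl cT).
  have [Wb Wz] : wcone L T b /\ wcone L T z by split; left.
  have [_ _ cvE] := cE.
  apply: (maxb (dominated T (b * z))).
  - by exists (b * z).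
  - move=> x hx; apply/hE; apply: (dominated_convex cT cE Tb) => //.
    exact: cvE bzE.
  - by apply/hE; apply: (convex_r cE Wb).
case: (relcone_tri cT yH) => [/pos //|/sLD/hD //|/pos /hD].
by rewrite gpredV => /hD.
Qed.

(** If b dominates all of H, the largest convex subgroup missing b has an
    archimedean, hence Abelian quotient; two independent elements in it would
    give infinitely many orders. *)
Lemma finite_top_step : (exists2 x, x \in H & x \notin L) ->
  exists2 K, rational_step K H & exists2 T', relcone H K T' & T' `<=` T.
Proof.
move=> [x xH xL].
have T0 : T !=set0.
  case: (relcone_tri cT xH) => [Tx|xL'|Tx]; [by exists x| |by exists x^-1].
  by rewrite xL' in xL.
have [b Tb bH] := finite_dominated_top T0.
have [D cD hD] := dominated_group cT Tb.
have eDH : D = H.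
  apply: groupClosed_ext => y; have [_ sDH _] := cD.
  by apply/idP/idP => [/sDH //|/bH/hD].
subst D; have [C [cC bC maxC]] := jump_group cT Tb.
have [nCH aC] := jump_abelian cT Tb cD hD cC bC maxC.
have cT' := convex_top cT cC; have [sLC sCH _] := cC.
have tC := relcone_torsion cT'.
exists C; last by exists [set x | T x /\ x \notin C] => // y [].
split=> //.
  by exists b => //; apply: (relcone_dom cT).
move=> y z yH zH ind.
have cC' := relcone_restrict cT sLC sCH.
exact: (two_generators_infinite sCH aC tC yH zH ind cC').
Qed.

End TopStep.

(** * Rational series *)

Section Chains.
Variable G : groupType.
Implicit Types (H K N : groupClosed G) (s : seq (groupClosed G)).

Let one : groupClosed G := trivg G.

Inductive rational_chain : groupClosed G -> seq (groupClosed G) -> Prop :=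
| ChainOne : rational_chain one [:: one]
| ChainStep K H s : rational_chain K s -> rational_step K H ->
    rational_chain H (rcons s H).

Lemma term_rcons s H i : term (rcons s H) i =
  if (i < size s)%N then term s i else if i == size s then H else one.
Proof. by rewrite /term nth_rcons. Qed.

Lemma term_rcons_lt s H i : (i < size s)%N -> term (rcons s H) i = term s i.
Proof. by rewrite term_rcons => ->. Qed.

Lemma term_rcons_size s H : term (rcons s H) (size s) = H.
Proof. by rewrite term_rcons ltnn eqxx. Qed.

Lemma chain_size H s : rational_chain H s -> (0 < size s)%N.
Proof. by case=> // *; rewrite size_rcons. Qed.

Lemma chain_last H s : rational_chain H s -> term s (size s).-1 = H.
Proof. by case=> // *; rewrite size_rcons term_rcons_size. Qed.

Lemma chain_series H s : rational_chain H s -> H =i predT -> rational_series s.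
Proof.
move=> cH HT; have s0 := chain_size cH; have sL := chain_last cH.
suff [h0 hs] : term s 0 = one /\
    forall i, (i.+1 < size s)%N -> rational_step (term s i) (term s i.+1).
  split; last by move=> i /hs/rational_stepP[].
  split=> //; [by rewrite h0|by rewrite sL|by move=> i /hs/rational_stepP[]].
elim: cH {HT s0 sL} => {H s} [|K H s cK [IH0 IHs] st]; first by [].
have s0 := chain_size cK; split; first by rewrite term_rcons_lt.
move=> i; rewrite size_rcons ltnS leq_eqVlt => /orP[/eqP is_|ilt].
  rewrite term_rcons_lt -?is_ // is_ term_rcons_size.
  by have := chain_last cK; rewrite -is_ /= => ->.
by rewrite !term_rcons_lt //; [apply: IHs|apply: ltnW].
Qed.

Lemma series_chain s : rational_series s ->
  exists2 H : groupClosed G, H =i predT & rational_chain H s.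
Proof.
move=> [[s0 h0 hT hn] hr]; exists (term s (size s).-1) => //.
have {hn hr} hs i : (i.+1 < size s)%N -> rational_step (term s i) (term s i.+1).
  by move=> ilt; apply/rational_stepP; split; [apply: hn|apply: hr].
move: s0 h0 hs; clear hT.
elim/last_ind: s => // s H IHs _; rewrite size_rcons succnK term_rcons_size.
case: (posnP (size s)) => [/size0nil-> /= h0 _|s0 h0 hs].
  suff -> : H = one by constructor.
  by apply: groupClosed_ext => x; rewrite -(h0 x) .
have sE : (size s).-1.+1 = size s by apply: prednK.
apply: (ChainStep (K := term s (size s).-1)).
  apply: IHs => //; first by rewrite term_rcons_lt in h0.
  move=> i ilt; have := hs i; rewrite !term_rcons_lt //; last exact: ltnW.
  by apply; apply: ltnW.
have := hs (size s).-1; rewrite sE term_rcons_size term_rcons_lt ?sE //.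
by apply.
Qed.

Lemma chain_inv H s : rational_chain H s -> (H = one /\ s = [:: one]) \/
  exists K s', [/\ s = rcons s' H, rational_step K H & rational_chain K s'].
Proof. by case=> [|K H' s' cK st]; [left|right; exists K, s']. Qed.

Lemma rational_step_trivg K : ~ rational_step K one.
Proof.
case=> _ _ _ [x]; rewrite inE => /eqP-> + _.
by rewrite gpred1.
Qed.

Lemma finite_cones_sub H K L T : relcone H K T ->
  finite_set (cones H L) -> finite_set (cones K L).
Proof.
move=> cT finH; have finj : {in cones K L &, injective (fun Q => Q `|` T)}.
  have E Q : relcone K L Q -> (Q `|` T) `&` [set x | x \in K] = Q.
    move=> cQ; apply/seteqP; split=> [x [[//|/(relcone_base cT)]] /=|x Qx].
      by move/negP.
    by split; [left|apply: (relcone_dom cQ)].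
  by move=> Q Q' /set_mem cQ /set_mem cQ' e; rewrite -(E Q cQ) -(E Q' cQ') e.
rewrite -(eq_finite_set (inj_card_eq finj)); apply: sub_finite_set finH.
by move=> _ [Q cQ <-]; apply: relcone_lex cQ.
Qed.

Lemma step_cone K H : rational_step K H -> exists T, relcone H K T.
Proof. by case=> [[sKH _]] aK tK _ _; apply: relcone_exists. Qed.

Lemma cone_sub H K T : relcone H one T -> {subset K <= H} ->
  exists Q, relcone K one Q.
Proof.
move=> cT sKH; exists [set x | T x /\ x \in K]; apply: (relcone_restrict cT) => //.
by move=> x; rewrite inE => /eqP->; apply: gpred1.
Qed.

(** Induction on the number of orders: those of K extend to H by the positive
    cone T' of the top step, and the reverse of T is not such an extension. *)
Lemma chain_exists H T : relcone H one T -> finite_set (cones H one) ->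
  exists s, rational_chain H s.
Proof.
move=> cT /finite_seqP[s es].
have {es} sub Q : relcone H one Q -> Q \in s.
  by move=> cQ; have : cones H one Q by []; rewrite es.
move: {2}(size s) (leqnn (size s)) => n; elim: n H T s cT sub => [|n IHn] H T s cT sub.
  by rewrite leqn0 size_eq0 => /eqP s0; have := sub _ cT; rewrite s0.
move=> sn; have [H1|nH1] := pselect (forall x, x \in H -> x \in one).
  exists [:: one]; suff -> : H = one by constructor.
  apply: groupClosed_ext => x; apply/idP/idP => [/H1//|].
  exact: (relcone_sub cT).
have finH : finite_set (cones H one).
  by apply: (sub_finite_set _ (finite_seq s)) => Q; apply: sub.
have [|K st [T' cT' sT']] := finite_top_step cT finH.
  by move/existsNP: nH1 => [x /not_implyP[xH /negP]]; exists x.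
have [[sKH _] _ _ [x xH xK] _] := st.
have [t Tt] : T' !=set0.
  case: (relcone_tri cT' xH) => [|xK'|]; [by exists x| |by exists x^-1].
  by rewrite xK' in xK.
have [Q0 cQ0] := cone_sub cT sKH.
pose opp := [set x | T x^-1].
have [|||sr chK] := IHn K Q0 [seq Q `&` [set x | x \in K] | Q <- rem opp s].
- exact: cQ0.
- move=> Q cQ; apply/mapP; exists (Q `|` T').
    apply: rem_mem; last exact/sub/(relcone_lex cT').
    apply/eqP => e; have : opp t by rewrite -e; right.
    by move=> TtV; apply: (relcone_asym cT (sT' _ Tt)); left.
  apply/seteqP; split=> [y Qy|y [[//|/(relcone_base cT')]] /=].
    by split; [left|apply: (relcone_dom cQ)].
  by move/negP.
- rewrite size_map size_rem; last exact/sub/relcone_opp.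
  by case: (size s) sn.
by exists (rcons sr H); apply: ChainStep chK st.
Qed.

End Chains.

Section Unique.
Variable G : groupType.
Implicit Types (H K N : groupClosed G) (s : seq (groupClosed G)).

Let one : groupClosed G := trivg G.

Lemma step_sub_eq H K K' : rational_step K H -> rational_step K' H ->
  {subset K <= K'} -> {subset K' <= K}.
Proof.
move=> [[_ _] _ tK _ rK] [[sK'H _] _ tK' [g gH gK'] _] sKK' h hK'.
apply: contrapT => /negP hK.
apply: (rK g h gH (sK'H _ hK')) => a b abK.
have a0 : a = 0%R.
  apply: (expgz_torsion tK' gH gK').
  by have := sKK' _ abK; rewrite gpredMr // expgz_mem.
split=> //; apply: (expgz_torsion tK (sK'H _ hK') hK).
by move: abK; rewrite a0 mul1g.
Qed.

(** If K and K' differ, then H modulo their intersection is torsion-free Abelian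
    and has two independent elements. *)
Lemma step_unique H K K' T : relcone H one T -> finite_set (cones H one) ->
  rational_step K H -> rational_step K' H -> K = K'.
Proof.
move=> cT finH st st'.
have [[sKH nK] aK tK _ _] := st; have [[sK'H nK'] aK' tK' _ _] := st'.
apply: contrapT => neq.
have pick (A B : groupClosed G) :
    rational_step A H -> rational_step B H -> A <> B ->
    exists2 x, x \in A & x \notin B.
  move=> stA stB nAB; apply: contrapT => /forall2NP h; apply: nAB.
  have sAB : {subset A <= B} by move=> x xA; have [|/negP/negPn] := h x.
  apply: groupClosed_ext => x; apply/idP/idP; first exact: sAB.
  exact: (step_sub_eq stA stB).
have [x xK xK'] := pick _ _ st st' neq.
have [y yK' yK] := pick _ _ st' st (fun e => neq (esym e)).
have [|u v [uK uK'] [vK vK']|u [uK uK']|N hN] :=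
    subgroup_exists (A := [set u | u \in K /\ u \in K']).
- by rewrite /= !gpred1.
- by rewrite /= !gpredM.
- by rewrite /= !gpredV.
have sNH : {subset N <= H} by move=> u /hN[/sKH].
have aN : abelian_mod N H.
  by move=> u v uH vH; apply/hN; split; [apply: aK|apply: aK'].
have tN : torsion_free_mod N H.
  move=> u n uH n0 /hN[uK uK']; apply/hN.
  by split; [apply: (tK _ n)|apply: (tK' _ n)].
have ind : independent_mod N x y.
  move=> a b /hN[abK abK']; split.
    apply: (expgz_torsion tK' (sKH _ xK) xK').
    by move: abK'; rewrite gpredMr // expgz_mem.
  apply: (expgz_torsion tK (sK'H _ yK') yK).
  by move: abK; rewrite gpredMl // expgz_mem.
have [Q cQ] := cone_sub cT sNH.
exact: (two_generators_infinite sNH aN tN (sKH _ xK) (sK'H _ yK') ind cQ).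
Qed.

Lemma chain_down H K T : rational_step K H -> relcone H one T ->
  finite_set (cones H one) ->
  finite_set (cones K one) /\ exists Q, relcone K one Q.
Proof.
move=> st cT finH; have [S cS] := step_cone st; split.
  exact: finite_cones_sub cS finH.
by apply: (cone_sub cT); apply: (relcone_sub cS).
Qed.

(** Peeling both series from the top, by [step_unique]. *)
Lemma chain_unique H T s s' : relcone H one T -> finite_set (cones H one) ->
  rational_chain H s -> rational_chain H s' -> s' = s.
Proof.
move=> cT finH cH; elim: cH s' T cT finH => {H s} [|K H s cK IHs st] s' T cT finH.
  by move=> /chain_inv[[]|[K [s0 [_ /rational_step_trivg]]]].
move=> /chain_inv[[H1 _]|[K' [s0 [-> st' cK']]]].
  by rewrite H1 in st; case: (rational_step_trivg st).
have eK := step_unique cT finH st st'; subst K'.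
have [finK [Q cQ]] := chain_down st cT finH.
by rewrite (IHs _ _ cQ finK cK').
Qed.

Lemma expgz_conj (x y : G) a : expgz x a ^ y = expgz (x ^ y) a.
Proof. by case: a => n /=; rewrite ?conjVg conjXg. Qed.

Lemma step_conj H K K' x : (forall y, (y ^ x \in H) = (y \in H)) ->
  (forall y, (y \in K') <-> (y ^ x \in K)) -> rational_step K H ->
  rational_step K' H.
Proof.
move=> nH eK [[sKH nK] aK tK [z zH zK] rK].
have nH' y : y \in H -> y ^ x \in H by rewrite nH.
split.
- split=> [y /eK/sKH|y k yH /eK kK]; first by rewrite nH.
  by apply/eK; rewrite conjJg nK ?nH'.
- by move=> y y' yH y'H; apply/eK; rewrite conjRg aK ?nH'.
- move=> y n yH n0 /eK yn; apply/eK/(tK _ n) => //; first exact: nH'.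
  by rewrite -conjXg.
- exists (z ^ x^-1); first by rewrite -nH conjgKV.
  by apply/negP => /eK; rewrite conjgKV; apply/negP.
- move=> y y' yH y'H ind; apply: (rK (y ^ x) (y' ^ x)); rewrite ?nH' //.
  by move=> a b; rewrite -!expgz_conj -conjMg => /eK/ind.
Qed.

(** Conjugating the top step of a series gives another top step, so uniqueness
    makes the series invariant. *)
Lemma chain_normal H T s x : relcone H one T -> finite_set (cones H one) ->
  rational_chain H s -> (forall y, (y ^ x \in H) = (y \in H)) ->
  forall i y, (i < size s)%N -> (y ^ x \in term s i) = (y \in term s i).
Proof.
move=> cT finH cH; elim: cH T cT finH => {H s} [|K H s cK IHs st] T cT finH nH i y.
  by case: i => // _; rewrite /term /= !inE conjg_eq1.
rewrite size_rcons ltnS leq_eqVlt => /orP[/eqP->|ilt].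
  by rewrite term_rcons_size nH.
rewrite term_rcons_lt //; have [finK [Q cQ]] := chain_down st cT finH.
apply: (IHs _ cQ finK) => // {}y.
have [|u v uK vK|u uK|K' hK'] := subgroup_exists (A := [set u | u ^ x \in K]).
- by rewrite /= conj1g gpred1.
- by rewrite /= conjMg gpredM.
- by rewrite /= conjVg gpredV.
have st' := step_conj nH hK' st.
rewrite {2}(step_unique cT finH st st').
by apply/idP/idP => /hK'.
Qed.

(** An Abelian double quotient would have two independent elements, one from
    each step. *)
Lemma chain_no_double H T s : relcone H one T -> finite_set (cones H one) ->
  rational_chain H s -> forall i, (i.+2 < size s)%N ->
  ~ abelian_set (quotient (term s i) (term s i.+2)).
Proof.
move=> cT finH cH; elim: cH T cT finH => {H s} [|K H s cK IHs st] T cT finH i //.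
have [finK [Q cQ]] := chain_down st cT finH.
rewrite size_rcons ltnS leq_eqVlt => /orP[/eqP is_|ilt]; last first.
  rewrite !term_rcons_lt //; first exact: (IHs _ cQ).
  by apply: ltn_trans ilt.
rewrite is_ term_rcons_size term_rcons_lt -?is_ //.
have nT x y j : x \in H -> (j < size s)%N -> (y ^ x \in term s j) = (y \in term s j).
  move=> xH js; have := @chain_normal _ _ _ x cT finH (ChainStep cK st) _ j y.
  rewrite size_rcons term_rcons_lt //; apply; last exact: ltnW.
  move=> z; apply/idP/idP => zH; last exact: gpredJ.
  by rewrite -(conjgK x z) gpredJ ?gpredV.
have [[_ s1]|[K1 [s1 [es st1 cK1]]]] := chain_inv cK; first by rewrite s1 in is_.
have iE : i = (size s1).-1 by move: is_; rewrite es size_rcons => -[<-].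
have s1_0 := chain_size cK1.
have tK1 : term s i = K1.
  by rewrite es term_rcons_lt iE ?prednK // (chain_last cK1).
rewrite tK1.
have [[sK1K nK1] aK1 tfK1 [x xK xK1] _] := st1.
have [[sKH nK] aK tK [y yH yK] _] := st.
have sK1H : {subset K1 <= H} by move=> z /sK1K/sKH.
have nK1H : normal_in K1 H.
  split=> // z u zH uK1; rewrite -tK1 nT ?tK1 // -is_ //.
move/(abelian_quotientP nK1H) => aH.
have tH : torsion_free_mod K1 H.
  move=> z n zH n0 zn; apply: (tfK1 _ n) => //; apply: (tK _ n) => //.
  exact: sK1K.
have ind : independent_mod K1 x y.
  move=> a b abK1; have b0 : b = 0%R.
    apply: (expgz_torsion tK yH yK).
    by have := sK1K _ abK1; rewrite gpredMl // expgz_mem.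
  split=> //; apply: (expgz_torsion tfK1 xK xK1).
  by move: abK1; rewrite b0 mulg1.
have [Q1 cQ1] := cone_sub cT sK1H.
exact: (two_generators_infinite sK1H aH tH (sKH _ xK) yH ind cQ1).
Qed.

End Unique.

(** * Orders and cones *)

Section Orders.
Variable G : groupType.

Definition order_cone (r : rel G) : set G := [set x | positive r x].

Definition cone_order (P : set G) : rel G :=
  fun x y : G => (x == y) || `[< P (x^-1 * y) >].

Lemma left_ordering_slt (r : rel G) x y :
  left_ordering r -> slt r x y = positive r (x^-1 * y).
Proof.
move=> [_ _ _ _ rM]; rewrite /positive /slt; congr (_ && _).
  apply/idP/idP => rxy; first by rewrite -(mulVg x); apply: rM.
  by rewrite -(mulg1 x) -(mulVKg x y); apply: rM.
by congr (~~ _); rewrite -[RHS](inj_eq (mulgI x)) mulg1 mulVKg.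
Qed.

Lemma order_coneK (r : rel G) : left_ordering r -> cone_order (order_cone r) = r.
Proof.
move=> lr; apply/funext => x; apply/funext => y; rewrite /cone_order /order_cone /=.
rewrite -(left_ordering_slt _ _ lr) asboolb /slt.
by case: eqVneq => [->|_] /=; [case: lr => ->|rewrite andbT].
Qed.

Lemma order_cone_relcone (r : rel G) (H : groupClosed G) :
  H =i predT -> C_ordering r -> relcone H (trivg G) (order_cone r).
Proof.
move=> HT [lr Cr]; have [rr ra rt rtot rM] := lr.
have posM x y : positive r x -> positive r y -> positive r (x * y).
  rewrite /positive /slt => /andP[rx x1] /andP[ry y1].
  have rxy : r x (x * y) by rewrite -{1}(mulg1 x) rM.
  rewrite (rt x) //=; apply/eqP => xy1.
  by rewrite -xy1 in rxy; case/eqP: x1; apply: ra; rewrite rx rxy.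
split=> /=.
- by move=> x _; rewrite HT.
- by move=> x _; rewrite HT.
- by move=> x; rewrite inE /order_cone /= /positive /slt eq_sym => /andP[].
- move=> x _; rewrite inE; have [|x1] := eqVneq x 1; first by constructor 2.
  case/orP: (rtot 1 x) => h; [constructor 1|constructor 3];
    rewrite /order_cone /= /positive /slt.
    by rewrite h eq_sym.
  rewrite eq_sym invg_eq1 x1 andbT -(mulVg x).
  by rewrite -{2}(mulg1 x^-1) rM.
- exact: posM.
- by move=> k x; rewrite inE => /eqP->; rewrite mul1g.
- by move=> x k Px; rewrite inE => /eqP->; rewrite mulg1.
- move=> f g Pg [Pf|]; last first.
    by rewrite inE => /eqP->; exists 2; rewrite mulg1 expg2 mulKg.
  have [n _] := Cr f g Pf Pg; rewrite left_ordering_slt // => Pn.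
  by exists n; rewrite -mulgA.
Qed.

Lemma cone_order_C (P : set G) (H : groupClosed G) : H =i predT ->
  relcone H (trivg G) P -> C_ordering (cone_order P).
Proof.
move=> HT cP; have P1 x y : P (x^-1 * y) -> x != y.
  by move=> h; apply/eqP => exy; apply: (relcone1 cP); move: h; rewrite exy mulVg.
have posE x : positive (cone_order P) x = `[< P x >].
  rewrite /positive /slt /cone_order invg1 mul1g.
  case: eqVneq => [<-|] /=; last by rewrite andbT.
  by apply/esym/asboolP; apply: (relcone1 cP).
have lP : left_ordering (cone_order P).
  split; rewrite /cone_order.
  - by move=> x; rewrite eqxx.
  - move=> x y /andP[/orP[/eqP//|/asboolP xy] /orP[/eqP//|/asboolP yx]].
    by case: (relcone1 cP); have := relconeM cP xy yx; rewrite !groupE.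
  - move=> y x z /orP[/eqP->//|/asboolP xy] /orP[/eqP<-|/asboolP yz].
      by rewrite (asboolT xy) orbT.
    apply/orP; right; apply/asboolP.
    by have := relconeM cP xy yz; rewrite !groupE.
  - move=> x y; have : x^-1 * y \in H by rewrite HT.
    move=> /(relcone_tri cP)[xy|/eqP xy|]; first by rewrite (asboolT xy) orbT.
      by rewrite -(mulVKg x y) xy mulg1 eqxx.
    by rewrite invgM invgK => yx; rewrite (asboolT yx) !orbT.
  - move=> f g h /orP[/eqP->|gh]; first by rewrite eqxx.
    by rewrite invgM !mulgA mulgVK gh orbT.
split=> // f g; rewrite !posE => /asboolP Pf /asboolP Pg.
exists 2 => //; rewrite left_ordering_slt // posE; apply/asboolP.
by rewrite expg2 !mulgA; apply: (relcone_conrad2 cP) => //; left.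
Qed.

Lemma cone_orderK (P : set G) (H : groupClosed G) :
  relcone H (trivg G) P -> order_cone (cone_order P) = P.
Proof.
move=> cP; rewrite /order_cone /positive /slt /cone_order; apply/seteqP.
split=> x /=; rewrite invg1 mul1g.
  by case: eqVneq => //= _; rewrite andbT => /asboolP.
move=> Px; rewrite (asboolT Px) orbT /=; apply/eqP => x1.
by apply: (relcone1 cP); rewrite x1.
Qed.

Lemma order_cone_image (H : groupClosed G) : H =i predT ->
  order_cone @` C_orderings G = cones H (trivg G).
Proof.
move=> HT; apply/seteqP; split=> [_ [r Cr <-]|P cP].
  exact: order_cone_relcone.
exists (cone_order P); first exact: cone_order_C cP.
exact: cone_orderK cP.
Qed.

Lemma order_cone_inj : {in C_orderings G &, injective order_cone}.
Proof.
move=> r r' /set_mem[lr _] /set_mem[lr' _] e.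
by rewrite -(order_coneK lr) -(order_coneK lr') e.
Qed.

End Orders.

Lemma finite_orderings_series (G : groupType) :
  C_orderable G -> finite_set (C_orderings G) ->
  exists s : seq (groupClosed G),
    [/\ rational_series s, forall s', rational_series s' -> s' = s,
        normal_series s & no_abelian_double_step s].
Proof.
move=> [r Cr] finG.
have [|||H hH] := @subgroup_exists G setT; try by [].
have HT : H =i predT by move=> x; apply/hH.
have finH : finite_set (cones H (trivg G)).
  by rewrite -(order_cone_image HT); apply: finite_image.
have cT := order_cone_relcone HT Cr.
have [s cs] := chain_exists cT finH; exists s; split.
- exact: chain_series cs HT.
- move=> s' /series_chain[H' HT' cs'].
  have eH : H' = H by apply: groupClosed_ext => x; rewrite HT HT'.
  by rewrite eH in cs'; apply: chain_unique cT finH cs cs'.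
- by move=> i ilt x y; rewrite (chain_normal (x := x) cT finH cs) // => z; rewrite !HT.
- by move=> i; apply: chain_no_double cT finH cs i.
Qed.

(** * Convexity in groups with a rational series *)

Lemma step_dependent (G : groupType) (N H : groupClosed G) x y :
  rational_step N H -> x \in H -> y \in H -> y \notin N ->
  exists a b : int, a <> 0%R /\ expgz x a * expgz y b \in N.
Proof.
move=> [_ _ tN _ rk] xH yH yN; apply: contrapT => nex.
apply: (rk x y) => // a b abN.
have a0 : a = 0%R by apply: contrapT => a0; apply: nex; exists a, b.
split=> //; apply: (expgz_torsion tN yH yN).
by move: abN; rewrite a0 mul1g.
Qed.

Lemma expgz_mem_torsion (G : groupType) (N H : groupClosed G) x a :
  torsion_free_mod N H -> x \in H -> a <> 0%R -> expgz x a \in N -> x \in N.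
Proof.
by move=> tN xH a0; have [//|xN /(expgz_torsion tN xH xN)] := boolP (x \in N).
Qed.

Section DoubleStep.
Variables (G : groupType) (L K H : groupClosed G).
Hypotheses (stL : rational_step L K) (stK : rational_step K H).
Hypotheses (nLH : normal_in L H) (naLH : ~ abelian_mod L H).

(** Modulo L, the elements of H commuting with y form a subgroup; were K central,
    it would contain K, y and, by rank one of H / K, a power of every x. *)
Lemma double_step_noncentral :
  exists b x, [/\ b \in K, x \in H & [~ b, x] \notin L].
Proof.
have [[sLK _] aL tL _ _] := stL; have [[sKH nK] aK tK _ _] := stK.
have [_ nL] := nLH.
apply: contrapT => ncent.
have cent b x : b \in K -> x \in H -> [~ b, x] \in L.
  by move=> bK xH; apply: contrapT => /negP bx; apply: ncent; exists b, x.
apply: naLH => x y xH yH.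
have [yK|yK] := boolP (y \in K); first by rewrite -gpredV invgR cent.
have [a [b [a0 abK]]] := step_dependent stK xH yH yK.
have [|u v [uH uy] [vH vy]|u [uH uy]|Z hZ] :=
  subgroup_exists (A := [set u | u \in H /\ [~ u, y] \in L]).
- by rewrite /= comm1g !gpred1.
- split; first by rewrite gpredM.
  have -> : [~ u * v, y] = [~ u, y] ^ v * [~ v, y] by rewrite /commg /conjg !groupE.
  by rewrite gpredM ?nL.
- split; first by rewrite gpredV.
  have -> : [~ u^-1, y] = [~ u, y]^-1 ^ u^-1 by rewrite /commg /conjg !groupE.
  by rewrite nL ?gpredV.
have KZ : {subset K <= Z} by move=> u uK; apply/hZ; split; [apply: sKH|apply: cent].
have yZ : y \in Z by apply/hZ; split; rewrite ?commgg ?gpred1.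
have xaZ : expgz x a \in Z by have := KZ _ abK; rewrite gpredMr // expgz_mem.
have [n xnZ] : exists n, x ^+ n.+1 \in Z.
  case: a a0 xaZ {abK} => [[//|n]|n] _ /=; first by exists n.
  by rewrite gpredV; exists n.
have cK : [~ x, y] \in K by apply: aK.
apply: (tL _ n.+1) => //.
have [_] := (hZ _).1 xnZ.
suff pow m : ([~ x ^+ m, y])^-1 * [~ x, y] ^+ m \in L.
  by move=> xnL; have := pow n.+1; rewrite gpredMl // gpredV.
elim: m => [|m IHm]; first by rewrite !expg0 comm1g invg1 mulg1 gpred1.
have -> : [~ x ^+ m.+1, y]^-1 * [~ x, y] ^+ m.+1
  = ([~ x ^+ m, y]^-1 * [~ x, y] ^+ m) *
    ([~ [~ x, y], x ^+ m]^-1 ^ ([~ x, y] ^+ m)).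
  set c := [~ x, y].
  have -> : [~ x ^+ m.+1, y] = c ^ (x ^+ m) * [~ x ^+ m, y].
    by rewrite expgS /c /commg /conjg !groupE.
  by rewrite (expgS c m) /commg /conjg !groupE.
apply: gpredM => //; apply: nL; rewrite ?gpredXn ?gpredV ?cent ?gpredXn //.
by apply: sKH.
Qed.

Variable P : set G.
Let one : groupClosed G := trivg G.
Hypothesis cP : relcone H one P.
Let PK : set G := [set x | P x /\ x \in K].
Hypothesis cL : convex K one PK L.

Let sKH : {subset K <= H}. Proof. by case: stK => [[]]. Qed.

Let cPK : relcone K one PK.
Proof.
apply: (relcone_restrict cP) => // x; rewrite inE => /eqP->; exact: gpred1.
Qed.

(** D meets K outside L, so it contains L by convexity of L in K; then K / L
    has rank one and D is closed under roots. *)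
Lemma double_step_hull D c : convex H one P D -> P c -> c \in K -> c \notin L ->
  c \in D -> {subset K <= D}.
Proof.
move=> cD Pc cK ncL cD' k kK.
have PKc : PK c by split.
have LD : {subset L <= D}.
  move=> l lL; apply: (dominated_convex cP cD Pc cD').
  have [n [[h1 _] [h2 _]]] := convex_dominated cPK cL PKc ncL lL.
  by exists n.
have [a [b [a0 abL]]] := step_dependent stL kK cK ncL.
apply: (expgz_mem_torsion (relcone_torsion (convex_top cP cD)) (sKH kK) a0).
by have := LD _ abL; rewrite gpredMr // expgz_mem.
Qed.

Lemma pos_or_inv u : u \in H -> u \notin L -> P u \/ P u^-1.
Proof.
move=> uH uL; case: (relcone_tri cP uH) => [|/eqP u1|]; [by left| |by right].
by rewrite u1 gpred1 in uL.
Qed.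

(** Take b in K and x in H that do not commute modulo L. Every convex subgroup
    meeting K outside L contains K, and the largest one missing b contains the
    commutator of b with whatever b dominates; so b dominates K only. *)
Lemma double_step_convex : convex H one P K.
Proof.
have [[sLK _] aL tL _ _] := stL; have [[_ nK] aK tK _ _] := stK.
have [b [x [bK xH bxL Pb]]] : exists b x,
    [/\ b \in K, x \in H, [~ b, x] \notin L & P b].
  have [b [x [bK xH bxL]]] := double_step_noncentral.
  have bL : b \notin L.
    apply: contra bxL => bL.
    by rewrite commgEl gpredM ?gpredV // nLH.2.
  have [Pb|PbV] := pos_or_inv (sKH bK) bL; first by exists b, x.
  exists b^-1, x; rewrite gpredV; split=> //; apply: contra bxL => bxL.
  have -> : [~ b, x] = [~ b^-1, x]^-1 ^ b by rewrite /commg /conjg !groupE.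
  by rewrite nLH.2 ?gpredV // sKH.
have bL : b \notin L.
  by apply: contra bxL => bL; rewrite commgEl gpredM ?gpredV // nLH.2.
have [D cD hD] := dominated_group cP Pb; have [_ sDH _] := cD.
have bD : b \in D by apply/hD/(dominated_refl cP).
have KD := double_step_hull cD Pb bK bL bD.
have [C [cC bC maxC]] := jump_group cP Pb.
have [_ aC] := jump_abelian cP Pb cD hD cC bC maxC.
suff -> : K = D by [].
apply: groupClosed_ext => g; apply/idP/idP => [/KD//|gD].
apply: contrapT => /negP gK.
have [a [c [a0 acK]]] := step_dependent stK xH (sDH _ gD) gK.
have xD : x \in D.
  apply: (expgz_mem_torsion (relcone_torsion (convex_top cP cD)) xH a0).
  by have := KD _ acK; rewrite gpredMr // expgz_mem.
have bxC : [~ b, x] \in C by apply: aC.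
have bxK : [~ b, x] \in K by rewrite commgEl gpredM ?gpredV // nK.
case/negP: bC; case: (pos_or_inv (sKH bxK) bxL) => Pc.
  exact: (double_step_hull cC Pc bxK bxL bxC).
by apply: (double_step_hull cC Pc) => //; rewrite gpredV.
Qed.

End DoubleStep.

(** * Counting the orders *)

Section StepOrders.
Variables (G : groupType) (K H : groupClosed G).
Hypothesis st : rational_step K H.

(** Some product of powers of x and t lies in K; if x and t have the same sign
    for T and opposite signs for T', it lies outside K for T or for T'. *)
Lemma step_cone_sub T T' t : relcone H K T -> relcone H K T' -> T t -> T' t ->
  T `<=` T'.
Proof.
move=> cT cT' Tt Tt' x Tx; have xH := relcone_dom cT Tx.
have xK := relcone_base cT Tx; have tK := relcone_base cT Tt.
case: (relcone_tri cT' xH) => // [|Tx']; first by rewrite (negPf xK).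
have [a [b [a0 abK]]] := step_dependent st xH (relcone_dom cT Tt) tK.
have W m : wcone K T (t ^+ m) by apply: (wconeX cT); left.
have W' m : wcone K T' (t ^+ m) by apply: (wconeX cT'); left.
have Tm n m := relcone_base cT (wconeMr cT (relconeX cT n Tx) (W m)).
have Tm' n m := relcone_base cT' (wconeMr cT' (relconeX cT' n Tx') (W' m)).
have Um n m := relcone_base cT (wconeMl cT (W m) (relconeX cT n Tx)).
have Um' n m := relcone_base cT' (wconeMl cT' (W' m) (relconeX cT' n Tx')).
(* The exponents of x and t have the same sign in the cases that T excludes. *)
case: a a0 abK => [[//|n]|n] _; case: b => m /= nmK.
- by have := Tm n m; rewrite nmK.
- by have := Um' n m.+1; rewrite -gpredV expVgn invgM invgK nmK.
- by have := Tm' n m; rewrite expVgn nmK.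
- by have := Um n m.+1; rewrite -gpredV invgM nmK.
Qed.

(** An order on a group of rank one is determined by the sign of one element. *)
Lemma step_cone_eq T T' : relcone H K T -> relcone H K T' ->
  T' = T \/ T' = [set x | T x^-1].
Proof.
move=> cT cT'; have [_ _ _ [t tH tK] _] := st.
have cO := relcone_opp cT; set O := [set x | T x^-1] in cO *.
have E S S' u : relcone H K S -> relcone H K S' -> S u -> S' u -> S = S'.
  move=> cS cS' Su S'u; apply/seteqP.
  by split; [apply: (step_cone_sub cS cS' Su)|apply: (step_cone_sub cS' cS S'u)].
have [u Tu] : T' !=set0.
  by case: (relcone_tri cT' tH) => [|tK'|]; [exists t|rewrite tK' in tK|exists t^-1].
case: (relcone_tri cT (relcone_dom cT' Tu)) => [Su|uK|Su].
- by left; apply: (E _ _ u).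
- by have := relcone_base cT' Tu; rewrite uK.
- by right; apply: (E _ _ u).
Qed.

(** If K is convex for every order, an order on H is the choice of an order on
    K and of one of the two orders on H / K. *)
Lemma step_count L (e : seq (set G)) : uniq e -> cones K L = [set` e] ->
  {subset L <= K} ->
  (forall P, relcone H L P -> convex H L P K) ->
  exists e' : seq (set G),
    [/\ uniq e', cones H L = [set` e'] & size e' = (size e).*2].
Proof.
move=> ue eE sLK cvx; have [T cT] := step_cone st.
have cO := relcone_opp cT; set O := [set x | T x^-1] in cO.
have eP Q : Q \in e <-> relcone K L Q.
  by have : [set` e] Q <-> cones K L Q by rewrite eE.
have inj S : relcone H K S -> {in e &, injective (fun Q => Q `|` S)}.
  move=> cS; have E Q : relcone K L Q -> (Q `|` S) `&` [set x | x \in K] = Q.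
    move=> cQ; apply/seteqP; split=> [x [[//|/(relcone_base cS)]] /=|x Qx].
      by move/negP.
    by split; [left|apply: (relcone_dom cQ)].
  by move=> Q Q' /eP cQ /eP cQ' eQ; rewrite -(E Q cQ) -(E Q' cQ') eQ.
exists ([seq Q `|` T | Q <- e] ++ [seq Q `|` O | Q <- e]); split.
- rewrite cat_uniq !map_inj_in_uniq ?ue //=; try exact: inj.
  rewrite andbT; apply/hasPn => _ /mapP[Q /eP cQ ->]; apply/negP => /mapP[Q' /eP cQ' eQ].
  have [_ _ _ [t tH tK] _] := st.
  have [u Tu] : T !=set0.
    by case: (relcone_tri cT tH) => [|tK'|]; [exists t|rewrite tK' in tK|exists t^-1].
  have : (Q `|` O) u by rewrite eQ; right.
  case=> [/(relcone_dom cQ) uK|Ou]; last by apply: (relcone_asym cT Tu); left.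
  by have := relcone_base cT Tu; rewrite uK.
- apply/seteqP; split=> [P cP|P]; rewrite /= mem_cat; last first.
    by case/orP => /mapP[Q /eP cQ ->]; [apply: relcone_lex cT cQ|apply: relcone_lex cO cQ].
  have cK := cvx _ cP; have [_ sKH _] := cK.
  have cQ := relcone_restrict cP sLK sKH.
  have split_P : P = [set x | P x /\ x \in K] `|` [set x | P x /\ x \notin K].
    apply/seteqP; split=> [x Px|x [[]|[]] //].
    by have [xK|xK] := boolP (x \in K); [left|right].
  apply/orP; rewrite split_P.
  by case: (step_cone_eq cT (convex_top cP cK)) => ->; [left|right];
     apply/mapP; exists [set x | P x /\ x \in K] => //; apply/eP.
- by rewrite size_cat !size_map addnn.
Qed.

End StepOrders.

Lemma card_uniq_seq (T : choiceType) (e : seq T) : uniq e -> [set` e] #= `I_(size e).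
Proof.
case: e => [|x0 e'] ue; first by rewrite set_nil /= II0.
move: ue; set e := x0 :: e' => ue.
have -> : [set` e] = nth x0 e @` `I_(size e).
  apply/seteqP; split=> [x /= xe|_ [i /= ie <-]]; last exact: mem_nth.
  by exists (index x e); [rewrite /mkset index_mem|apply: nth_index].
apply: inj_card_eq => i j /set_mem ie /set_mem je /eqP.
by rewrite nth_uniq // => /eqP.
Qed.

Lemma series_orderings_card (G : groupType) (n : nat) (s : seq (groupClosed G)) :
  size s = n.+1 -> rational_series s -> normal_series s ->
  no_abelian_double_step s -> C_orderings G #= `I_(2 ^ n)%N.
Proof.
move=> sn [[_ h0 hT hN] hR] nS nD; pose one := trivg G.
have st i : (i.+1 < size s)%N -> rational_step (term s i) (term s i.+1).
  by move=> ilt; apply/rational_stepP; split; [apply: hN|apply: hR].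
have t0 : term s 0 = one by apply: groupClosed_ext => x; rewrite h0.
have s1 (K : groupClosed G) : {subset one <= K}.
  by move=> x; rewrite inE => /eqP->; apply: gpred1.
have cvx i : (i.+1 < size s)%N -> forall P, relcone (term s i.+1) one P ->
    convex (term s i.+1) one P (term s i).
  elim: i => [|i IHi] ilt P cP; first by rewrite t0; apply: convex_refl cP.
  have stL := st i (ltnW ilt); have stK := st i.+1 ilt.
  have [[sLK _] _ _ _ _] := stL; have [[sKH _] _ _ _ _] := stK.
  have nL : normal_in (term s i) (term s i.+2).
    split=> [x /sLK/sKH //|x y _ yL]; apply: nS => //.
    exact: ltn_trans (ltnSn _) (ltnW ilt).
  apply: (double_step_convex stL stK nL _ cP).
    by move/(abelian_quotientP nL); apply: nD.
  by apply: IHi; [apply: ltnW|apply: (relcone_restrict cP)].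
have count i : (i < size s)%N -> exists e : seq (set G),
    [/\ uniq e, cones (term s i) one = [set` e] & size e = (2 ^ i)%N].
  elim: i => [|i IHi] ilt.
    exists [:: set0]; split=> //; rewrite t0; apply/seteqP; split=> P /=.
      move=> cP; rewrite inE; apply/eqP/seteqP; split=> // x Px.
      by have := relcone_base cP Px; rewrite (relcone_dom cP Px).
    by rewrite inE => /eqP->; split=> // x ->; constructor 2.
  have [e [ue eE se]] := IHi (ltnW ilt).
  have [e' [ue' eE' se']] := step_count (st i ilt) ue eE (s1 _) (cvx i ilt).
  by exists e'; split=> //; rewrite se' se expnS mul2n.
have [|e [ue eE <-]] := count n; first by rewrite sn.
have HT : term s n =i predT by move: hT; rewrite sn.
rewrite (card_eql (card_esym (inj_card_eq (@order_cone_inj G)))).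
by rewrite (order_cone_image HT) eE; apply: card_uniq_seq.
Qed.

Local Close Scope group_scope.

Theorem theoremB (G : groupType) :
  (C_orderable G -> finite_set (C_orderings G) ->
     exists s : seq (groupClosed G),
       [/\ rational_series s,
           forall s', rational_series s' -> s' = s,
           normal_series s
         & no_abelian_double_step s])
  /\
  (forall (n : nat) (s : seq (groupClosed G)),
     size s = n.+1 ->
     rational_series s ->
     normal_series s ->
     no_abelian_double_step s ->
     C_orderings G #= `I_(2 ^ n)).
Proof.
by split=> [|n s]; [apply: finite_orderings_series|apply: series_orderings_card].
Qed.
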